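(* Let $n=8$ and consider the point of $\mathcal{U}_8$ \[ (a_1,\ldots,a_8)=(7,5,3,1,-1,-3,-5,-7),\qquad (c_1,\ldots,c_7)=(7,12,15,16,15,12,7), \] at which $P_8(\lambda,t)=\prod_{q\in\{1,3,5,7\}}\bigl[\lambda^2-q^2(1+t)\bigr]$. Fix any one of the four quadratic factors and group it against the product of the other three. At the resulting point, the corresponding $2+6$ bounded-coefficient incidence Jacobian (a $24\times 33$ matrix) has full row rank $24$. Likewise, for each of the three unordered groupings of the four quadratics into two pairs, the corresponding $4+4$ incidence Jacobian (a $24\times 31$ matrix) has full row rank $24$. Consequently, the images in $\mathcal{U}_8$ of these local branches of the incidence variety (under projection to the chain parameters) have codimensions $6$ and $8$ in $\mathcal{U}_8$, respectively.
   Context: For $a_1,\ldots,a_n,c_1,\ldots,c_{n-1}\in\mathbb{C}$, the polynomial $P_n(\lambda,t)$ is defined by $P_0=1$, $P_1=\lambda+a_1$, $P_k=(\lambda+a_k)P_{k-1}-t\,c_{k-1}P_{k-2}$ for $2\le k\le n$, and $\mathcal{U}_n=\{(a,c)\in\mathbb{C}^{2n-1}: a_i\neq a_j\ (i\neq j),\ c_1\cdots c_{n-1}\neq 0\}$. The $d+(n-d)$ bounded-coefficient incidence problem has as variables the chain parameters $(a,c)\in\mathcal{U}_n$ and the coefficients $f_{j,k}$ ($1\le j\le d$, $0\le k\le\lfloor j/2\rfloor$), $g_{j,k}$ ($1\le j\le n-d$, $0\le k\le\lfloor j/2\rfloor$) of \[F=\lambda^d+\sum_{j=1}^d\Bigl(\sum_{k=0}^{\lfloor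 j/2\rfloor}f_{j,k}t^k\Bigr)\lambda^{d-j},\qquad G=\lambda^{n-d}+\sum_{j=1}^{n-d}\Bigl(\sum_{k=0}^{\lfloor j/2\rfloor}g_{j,k}t^k\Bigr)\lambda^{n-d-j},\] and as equations the vanishing of the coefficients of $\lambda^{n-j}t^k$ in $FG-P_n$ for all $1\le j\le n$, $0\le k\le\lfloor j/2\rfloor$. The incidence variety is its solution set, and the incidence Jacobian is the matrix of partial derivatives of these equations with respect to all chain and factor variables. For $n=8$ there are $24$ equations, and $33$ variables for $d=2$, $31$ variables for $d=4$. The local incidence branch at a point is the germ of the incidence variety at that point. *)

(* Defs.v *)
From HB Require Import structures.
From mathcomp Require Import all_boot all_order all_algebra.
From mathcomp Require Import complex.
From mathcomp Require Import all_classical all_reals all_analysis.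

Set Implicit Arguments.
Unset Strict Implicit.
Unset Printing Implicit Defensive.

Import Order.TTheory GRing.Theory Num.Theory.
Import numFieldNormedType.Exports.

Local Open Scope classical_set_scope.
Local Open Scope ring_scope.

(* The structure is registered on the name [cplx R] so that R[i] is seen as an
   abstract numFieldType, which gives it (and its matrices) the norm topology. *)
Definition cplx (R : realType) : numFieldType := R[i].

Section Incidence.
Variable C : numFieldType.

(* A polynomial in lambda and t is an element of {poly {poly C}}: lambda is the
   outer variable, t the inner one, so the coefficient of lambda^i t^k in F is
   F`_i`_k. *)
Definition lam : {poly {poly C}} := 'X.
Definition tvar : {poly {poly C}} := ('X : {poly C})%:P.
Definition constp (z : C) : {poly {poly C}} := z%:P%:P.

Fixpoint Ppoly (a c : nat -> C) (k : nat) : {poly {poly C}} :=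
  match k with
  | 0 => 1
  | k1.+1 =>
    match k1 with
    | 0 => lam + constp (a 1%N)
    | k2.+1 => (lam + constp (a k)) * Ppoly a c k1
               - tvar * constp (c k1) * Ppoly a c k2
    end
  end.

(* Chain parameters (a, c) form a row vector of length n + (n - 1).  The
   functions chain_a and chain_c are indexed from 1; their values outside 1..n
   and 1..n-1 respectively are not used by [chainP]. *)
Definition rventry n (u : 'rV[C]_n) (k : nat) : C :=
  if insub k is Some i then u 0 i else 0.

Definition chain_a n (p : 'rV[C]_(n + n.-1)) (k : nat) : C :=
  rventry (lsubmx p) k.-1.
Definition chain_c n (p : 'rV[C]_(n + n.-1)) (k : nat) : C :=
  rventry (rsubmx p) k.-1.

Definition chainP n (p : 'rV[C]_(n + n.-1)) : {poly {poly C}} :=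
  Ppoly (chain_a p) (chain_c p) n.

Definition chainU n : set 'rV[C]_(n + n.-1) :=
  [set p | injective (lsubmx p 0) /\ \prod_(i < n.-1) rsubmx p 0 i != 0].

(* Index pairs (j, k) with 1 <= j <= d and 0 <= k <= j./2; the element
   Tagged _ k over j : 'I_d stands for the pair (j.+1, k). *)
Definition bidx (d : nat) : finType := {j : 'I_d & 'I_(j.+1)./2.+1}.

(* Monic polynomial of degree d in lambda with the given bounded coefficients. *)
Definition bpoly d (f : 'rV[C]_#|bidx d|) : {poly {poly C}} :=
  lam ^+ d +
  \sum_(s : bidx d)
    constp (f 0 (enum_rank s)) * tvar ^+ tagged s * lam ^+ (d - (tag s).+1).

(* Vector of the coefficients of lambda^(d - j) t^k, 1 <= j <= d, k <= j./2. *)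
Definition bcoefs d (F : {poly {poly C}}) : 'rV[C]_#|bidx d| :=
  \row_e let s : bidx d := enum_val e in F`_(d - (tag s).+1)`_(tagged s).

(* A point (a, c, f, g) of the ambient space of the d + (n - d) problem. *)
Definition ivec n d := 'rV[C]_(n + n.-1 + (#|bidx d| + #|bidx (n - d)|)).

Definition ichain n d (x : ivec n d) : 'rV[C]_(n + n.-1) := lsubmx x.
Definition iF n d (x : ivec n d) : {poly {poly C}} := bpoly (lsubmx (rsubmx x)).
Definition iG n d (x : ivec n d) : {poly {poly C}} := bpoly (rsubmx (rsubmx x)).

Definition mkpoint n d (p : 'rV[C]_(n + n.-1)) (F G : {poly {poly C}}) :
  ivec n d := row_mx p (row_mx (bcoefs d F) (bcoefs (n - d) G)).

Definition ieqs n d (x : ivec n d) : 'rV[C]_#|bidx n| :=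
  bcoefs n (iF x * iG x - chainP (ichain x)).

Definition incidence n d : set (ivec n d) :=
  [set x | chainU (ichain x) /\ ieqs x = 0].

(* One row per equation, one column per variable. *)
Definition ijac n d (x : ivec n d) :
  'M[C]_(#|bidx n|, n + n.-1 + (#|bidx d| + #|bidx (n - d)|)) :=
  \matrix_(e, v) 'D_(delta_mx 0 v) (fun y : ivec n d => ieqs y 0 e) x.

(* S contains a complex submanifold of dimension k.  Every submanifold is
   locally the image of a holomorphic immersion of an open subset of C^k, and
   conversely an immersion is an embedding on a smaller open set.  Over the
   complex field, "differentiable at every point of an open set" is
   "holomorphic". *)
Definition contains_submanifold N (S : set 'rV[C]_N) (k : nat) : Prop :=
  exists (V : set 'rV[C]_k) (phi : 'rV[C]_k -> 'rV[C]_N),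
    [/\ open V, V !=set0,
        forall u, V u -> differentiable phi u /\ injective ('d phi u)
      & phi @` V `<=` S].

(* Dimension of an arbitrary subset of C^N: the largest dimension of a complex
   submanifold contained in it. *)
Definition has_dim N (S : set 'rV[C]_N) (k : nat) : Prop :=
  contains_submanifold S k /\
  forall m, contains_submanifold S m -> (m <= k)%N.

Definition has_codim N (S : set 'rV[C]_N) (r : nat) : Prop :=
  exists2 k, has_dim S k & (k + r = N)%N.

(* The image in U_n of the germ at x of the incidence variety has codimension
   r: so does the image of every sufficiently small neighbourhood of x.  U_n is
   open in C^(2n-1), so codimensions in U_n and in C^(2n-1) agree. *)
Definition branch_image_codim n d (x : ivec n d) (r : nat) : Prop :=
  exists2 W0 : set (ivec n d), nbhs x W0 &
    forall W : set (ivec n d), nbhs x W -> W `<=` W0 ->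
      has_codim (@ichain n d @` (@incidence n d `&` W)) r.

Definition chain8 : 'rV[C]_(8 + 8.-1) :=
  row_mx (\row_(i < 8) [:: 7; 5; 3; 1; -1; -3; -5; -7]`_i)
         (\row_(i < 7) [:: 7; 12; 15; 16; 15; 12; 7]`_i).

(* The four values of q are 2i + 1 for i < 4. *)
Definition quad (i : 'I_4) : {poly {poly C}} :=
  lam ^+ 2 - constp ((2 * i + 1)%N%:R ^+ 2) * (1 + tvar).

Definition quads (A : {set 'I_4}) : {poly {poly C}} := \prod_(i in A) quad i.

(* Point over chain8 with F the product of the quadratics in A (d = 2 #|A|) and
   G the product of the others. *)
Definition point8 d (A : {set 'I_4}) : ivec 8 d :=
  mkpoint d chain8 (quads A) (quads (~: A)).

End Incidence.

(* Main.v *)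
From Stdlib Require Import BinInt.
Require Import Defs.
From mathcomp Require Import all_boot all_order all_algebra.
From mathcomp Require Import complex ring lra ssrZ.
From mathcomp Require Import all_classical all_reals all_analysis.

Set Implicit Arguments.
Unset Strict Implicit.
Unset Printing Implicit Defensive.

Import Order.TTheory GRing.Theory Num.Theory.
Import numFieldNormedType.Exports.

Local Open Scope classical_set_scope.
Local Open Scope ring_scope.

(** The 24 incidence equations are polynomial in the 15 chain parameters and
    the coefficients of F and G.  Let k be 9 for the grouping 2 + 6 and 7 for
    4 + 4.  Adjoin to the equations k well-chosen chain coordinates (those of
    a_1, ..., a_8, c_1 when k = 9, those of a_1, ..., a_6, c_1 when k = 7).
    The resulting system is square, and its Jacobian at each of the ten points
    has trivial kernel; this is a statement about integer matrices, decided by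
    a fraction-free elimination ([kertriv], [zcheck2], [zcheck4]).  All the
    rest follows from it.

    - The equations alone have full row rank 24 ([slope_rank]).

    - Near the point x the augmented map Phi is so close to its derivative at
      x that |y - z| <= C |Phi y - Phi z|, and a contraction argument makes it
      locally onto ([contraction_surj]), hence locally invertible with
      holomorphic inverse.  Setting the equations to 0 in this inverse
      parametrises the branch by the k adjoined coordinates; followed by the
      projection to the chain parameters the parametrisation is an immersion,
      because its adjoined coordinates are the parameters themselves.  So the
      image contains a submanifold of dimension k ([local_image_lower]).

    - Let phi be an immersion into the image.  Points of the image lift to
      points of the branch, so the displayed inequality bounds phi u - phi u'
      by C times its k adjoined coordinates.  Hence the adjoined coordinates
      are injective on the image of the differential of phi, whose rank is
      therefore at most k ([local_image_upper]).

    Together these give codimension 15 - k, i.e. 6 and 8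
    ([local_image_codim]).  Smoothness is handled by difference quotients: f
    has a differential when f y - f z is a sum of terms (y_i - z_i) q_i(y, z)
    with q_i continuous.  This property is stable under the ring operations,
    so it passes to the coefficients of F G - P_n ([ieqs_diff]), and it yields
    directly the uniform estimates used above ([slope_near]). *)

(** * Limits of geometrically convergent sequences *)

(** Completeness of a normed field, in the form used for Picard iteration:
    sequences with geometrically decreasing increments converge with an
    explicit rate, and no nonzero element is bounded by a geometric sequence
    tending to 0.  The constant 4 leaves room for treating real and imaginary
    parts separately. *)
Definition geom_complete (K : numFieldType) : Prop :=
  (forall (u : nat -> K) (r : K),
     (forall k, `|u k.+1 - u k| <= r / 2 ^+ k) ->
     exists l, forall k, `|l - u k| <= 4 * r / 2 ^+ k) /\
  (forall z r : K, (forall k, `|z| <= r / 2 ^+ k) -> z = 0).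

Lemma real_geom_limit (R : realType) (u : nat -> R) (r : R) :
  (forall k, `|u k.+1 - u k| <= r / 2 ^+ k) ->
  exists l, forall k, `|l - u k| <= 2 * r / 2 ^+ k.
Proof.
move=> ur.
pose e k : R := 2 * r / 2 ^+ k.
have eS k : e k.+1 + r / 2 ^+ k = e k.
  rewrite /e exprS invfM !mulrA (mulrAC 2 r) divff ?pnatr_eq0// mul1r.
  by rewrite -mulrDl -mulr2n mulr_natl.
have r0 : 0 <= r by have := ur 0%N; rewrite expr0 divr1; apply: le_trans.
have e0 k : 0 <= e k by rewrite /e divr_ge0 ?mulr_ge0// exprn_ge0.
have vS k m : u k - e k <= u (k + m)%N - e (k + m)%N.
  elim: m => [|m IH]; first by rewrite addn0.
  apply: le_trans IH _; rewrite addnS.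
  have := ur (k + m)%N; rewrite ler_norml => /andP[+ _].
  by rewrite -(eS (k + m)%N); lra.
have wS k m : u (k + m)%N + e (k + m)%N <= u k + e k.
  elim: m => [|m IH]; first by rewrite addn0.
  apply: le_trans IH; rewrite addnS.
  have := ur (k + m)%N; rewrite ler_norml => /andP[_ +].
  by rewrite -(eS (k + m)%N); lra.
have vw k m : u k - e k <= u m + e m.
  apply: le_trans (vS k m) _; apply: le_trans _ (wS m k).
  by rewrite [(m + k)%N]addnC lerD2l ge0_cp.
(* the intervals [u k - e k, u k + e k] are nested *)
exists (sup (range (fun k => u k - e k))) => k.
rewrite ler_distl; apply/andP; split.
  apply: ub_le_sup; last by exists k.
  by exists (u 0%N + e 0%N) => _ [m _ <-]; exact: vw.
apply: ge_sup; first by exists (u 0%N - e 0%N), 0%N.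
by move=> _ [m _ <-]; exact: vw.
Qed.

Lemma real_geom_zero (R : realType) (z r : R) :
  (forall k, z <= r / 2 ^+ k) -> z <= 0.
Proof.
move=> zr; rewrite leNgt; apply/negP => z0.
have r0 : 0 < r.
  by have := zr 0%N; rewrite expr0 divr1; apply: lt_le_trans.
have := zr (Num.truncn (r / z)).+1; apply/negP; rewrite -ltNge.
rewrite ltr_pdivrMr ?exprn_gt0// mulrC -ltr_pdivrMr//.
apply: lt_trans (truncnS_gt _) _.
by rewrite -natrX ltr_nat ltn_expl.
Qed.

Lemma cplx_geom_complete (R : realType) : geom_complete (cplx R).
Proof.
have pos2 k : (2 ^+ k)%:C%C = 2 ^+ k :> R[i].
  by rewrite rmorphXn/= (_ : 2%:C%C = 2)// -[2]/(2%:R) rmorph_nat.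
have rE (r : R[i]) k : 0 <= r -> r / 2 ^+ k = (complex.Re r / 2 ^+ k)%:C%C.
  move=> r0; rewrite rmorphM fmorphV/= pos2; congr (_ / _).
  by move: r0; case: r => a b; rewrite lecE/= => /andP[/eqP-> _].
split.
- move=> u r ur.
  have r0 : 0 <= r.
    by have := ur 0%N; rewrite expr0 divr1; apply: le_trans.
  have [l1 Hl1] : exists l, forall k,
      `|l - complex.Re (u k)| <= 2 * complex.Re r / 2 ^+ k.
    apply: real_geom_limit => k; rewrite -raddfB/= -lecR.
    by apply: le_trans (normc_ge_Re _) _; rewrite -rE//; exact: ur.
  have [l2 Hl2] : exists l, forall k,
      `|l - complex.Im (u k)| <= 2 * complex.Re r / 2 ^+ k.
    apply: real_geom_limit => k; rewrite -raddfB/= -lecR.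
    have Im_le (x : R[i]) : `|complex.Im x|%:C%C <= `|x|.
      case: x => a b; rewrite normc_def/= lecR -sqrtr_sqr.
      by rewrite ler_wsqrtr// lerDr sqr_ge0.
    by apply: le_trans (Im_le _) _; rewrite -rE//; exact: ur.
  exists (l1 +i* l2)%C => k.
  have -> : (l1 +i* l2)%C - u k =
      (l1 - complex.Re (u k))%:C%C + 'i%C * (l2 - complex.Im (u k))%:C%C.
    by case: (u k) => a b; simpc.
  apply: le_trans (ler_normD _ _) _.
  have nR (x : R) : `|x%:C%C| = `|x|%:C%C :> R[i].
    by rewrite normc_def/= expr0n addr0 sqrtr_sqr.
  have ni : `|'i%C| = 1 :> R[i].
    by rewrite normc_def/= expr0n expr1n add0r sqrtr1.
  rewrite normrM ni mul1r !nR -rmorphD/=.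
  have -> : 4 * r / 2 ^+ k = (4 * complex.Re r / 2 ^+ k)%:C%C.
    by rewrite -mulrA rE// !mulr_natl -raddfMn/= mulrnAl.
  rewrite lecR.
  apply: le_trans (lerD (Hl1 k) (Hl2 k)) _.
  by rewrite -mulrDl -mulrDl -natrD.
- move=> z r zr.
  have r0 : 0 <= r.
    by have := zr 0%N; rewrite expr0 divr1; apply: le_trans.
  apply/eqP; rewrite -normr_le0.
  have : complex.Re `|z : R[i]| <= 0.
    apply: (@real_geom_zero _ _ (complex.Re r)) => k.
    rewrite -lecR -rE//; apply: le_trans (zr k).
  by rewrite -lecR (_ : (complex.Re `|z : R[i]|)%:C%C = `|z : R[i]|).
Qed.

(** * Norm and differential estimates *)

Section MatrixNorm.
Variable K : numFieldType.

Lemma mxnorm_entry m n (A : 'M[K]_(m, n)) i j : `|A i j| <= `|A|.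
Proof.
exact: (le_bigmax (0%:nng : {nonneg K}) (fun ij => `|A ij.1 ij.2|%:nng) (i, j)).
Qed.

Lemma mxnorm_le m n (A : 'M[K]_(m, n)) (c : K) :
  0 <= c -> (forall i j, `|A i j| <= c) -> `|A| <= c.
Proof.
move=> c0 Ac; rewrite [leLHS]mx_normE.
move: c0 (c0) Ac => /nonnegP[{}c] c0 Ac.
rewrite num_le; apply/bigmax_leP => /=; rewrite -num_le /=.
by split => // ij _; exact: Ac.
Qed.

Lemma lsubmx_norm m n (v : 'rV[K]_(m + n)) : `|lsubmx v| <= `|v|.
Proof. by apply: mxnorm_le => // i j; rewrite mxE mxnorm_entry. Qed.

Lemma colsub_norm m n (s : 'I_m -> 'I_n) (v : 'rV[K]_n) : `|colsub s v| <= `|v|.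
Proof. by apply: mxnorm_le => // i j; rewrite mxE mxnorm_entry. Qed.

Lemma row_mx0_norm m n (v : 'rV[K]_n) : `|row_mx (0 : 'rV[K]_m) v| <= `|v|.
Proof.
apply: mxnorm_le => // i j; case: (split_ordP j) => k ->.
  by rewrite row_mxEl mxE normr0.
by rewrite row_mxEr mxnorm_entry.
Qed.

Lemma mulmx_norm m n (v : 'rV[K]_m) (B : 'M[K]_(m, n)) (c : K) :
  0 <= c -> (forall i j, `|B i j| <= c) -> `|v *m B| <= m%:R * c * `|v|.
Proof.
move=> c0 Bc; apply: mxnorm_le => [|i j]; first by rewrite !mulr_ge0.
rewrite mxE; apply: le_trans (ler_norm_sum _ _ _) _.
apply: (@le_trans _ _ (\sum_(k < m) c * `|v|)).
  apply: ler_sum => k _; rewrite normrM mulrC ler_pM//.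
  by rewrite mxnorm_entry.
by rewrite sumr_const card_ord -mulrA mulr_natl.
Qed.

Lemma mulmx_bounded m n (B : 'M[K]_(m, n)) :
  exists2 c : K, 0 < c & forall v : 'rV[K]_m, `|v *m B| <= c * `|v|.
Proof.
exists (m%:R * `|B| + 1) => [|v]; first by rewrite ltr_wpDl// mulr_ge0.
apply: le_trans (@mulmx_norm _ _ v B `|B| _ _) _ => // [i j|].
  exact: mxnorm_entry.
by rewrite ler_wpM2r// lerDl.
Qed.

(** The bound has to be nonnegative: in a space without nonzero vectors any
    scalar, even one not comparable with 0, would satisfy the inequality. *)
Lemma bounded_linear_cts (V W : normedModType K) (f : {linear V -> W}) (c : K) :
  0 <= c -> (forall v, `|f v| <= c * `|v|) -> continuous f.
Proof.
move=> c0 fc; apply: bounded_linear_continuous; apply/linear_boundedP.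
exists c; split=> [|r cr v]; first exact: ger0_real.
by apply: le_trans (fc v) _; rewrite ler_wpM2r// ltW.
Qed.

Lemma differentiable_diff (V W : normedModType K) (f : V -> W)
    (df : {linear V -> W}) (x : V) :
  continuous df ->
  (forall eps : K, 0 < eps ->
    \forall h \near (0 : V), `|f (h + x) - f x - df h| <= eps * `|h|) ->
  differentiable f x /\ 'd f x = df :> (V -> W).
Proof.
move=> cdf fdf.
have E : f \o shift x = cst (f x) + df +o_ (0 : V) id.
  apply/eqaddoP => eps eps0; have := fdf eps eps0.
  apply: filterS => h.
  suff -> : (f \o shift x - (cst (f x) + df)) h = f (h + x) - f x - df h by [].
  by rewrite !fctE /= opprD addrA.
have D := diff_unique cdf E; split=> //.
by apply/diff_locallyP; rewrite D.
Qed.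

Lemma diff_estimate (V W : normedModType K) (f : V -> W) (x : V) :
  differentiable f x -> forall eps : K, 0 < eps ->
    \forall h \near (0 : V), `|f (h + x) - f x - 'd f x h| <= eps * `|h|.
Proof.
move=> /diff_locallyP[_ /eqaddoP E] eps eps0; have := E eps eps0.
apply: filterS => h.
suff -> : (f \o shift x - (cst (f x) + 'd f x)) h = f (h + x) - f x - 'd f x h by [].
by rewrite !fctE /= opprD addrA.
Qed.

Lemma pos_lower_bound (a b : K) : 0 < a -> 0 < b ->
  exists2 c, 0 < c & c <= a /\ c <= b.
Proof.
move=> a0 b0; have := real_leP (gtr0_real a0) (gtr0_real b0).
by case=> ab; [exists a|exists b] => //; rewrite ?lexx ?ltW.
Qed.

Lemma open_shift (V : normedModType K) (D : set V) (u : V) :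
  open D -> D u -> \forall h \near (0 : V), D (h + u).
Proof.
move=> Dopen Du; have /nbhs_normP[r /= r0 rD] := open_nbhs_nbhs (conj Dopen Du).
apply/nbhs_normP; exists r => //= h; rewrite /= sub0r normrN => hr.
by apply: rD => /=; rewrite opprD addrCA subrr addr0 normrN.
Qed.

End MatrixNorm.

(** * Contractions and difference quotients *)

Section LocalInverse.
Variable K : numFieldType.
Hypothesis HK : geom_complete K.

(** A map that differs from the identity by a contraction of ratio 1/2 on the
    closed ball of radius rho around x takes, on that ball, every value close
    enough to its value at x.  The point is the limit of the Picard iterates of
    the map sending y to y + (w - Phi y). *)
Lemma contraction_surj N (Phi : 'rV[K]_N -> 'rV[K]_N) (x : 'rV[K]_N) (rho : K) :
  (forall y z, `|y - x| <= rho -> `|z - x| <= rho ->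
     `|y - z - (Phi y - Phi z)| <= 2^-1 * `|y - z|) ->
  forall w, 4 * `|w - Phi x| <= rho ->
  exists2 y, `|y - x| <= 4 * `|w - Phi x| & Phi y = w.
Proof.
move=> ctr w; set s := `|w - Phi x| => srho.
have s0 : 0 <= s by exact: normr_ge0.
have rho0 : 0 <= rho by apply: le_trans srho; rewrite mulr_ge0.
have half2 : 2^-1 * rho + 4^-1 * rho <= rho.
  rewrite -mulrDl ler_piMl// (_ : _ + _ = 3 / 4); last by field.
  by rewrite ler_pdivrMr// mul1r ler_nat.
have sle : s <= 4^-1 * rho by rewrite ler_pdivlMl.
pose T y := y + (w - Phi y).
pose u k := iter k T x.
have uball k : `|u k - x| <= rho.
  elim: k => [|k IH]; first by rewrite /u /= subrr normr0.
  have -> : u k.+1 - x = (u k - x - (Phi (u k) - Phi x)) + (w - Phi x).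
    by rewrite /u iterS -/(u k) /T; apply/rowP => i; rewrite !mxE; ring.
  apply: le_trans (ler_normD _ _) _; apply: le_trans half2; apply: lerD => //.
  apply: le_trans (ctr _ _ IH _) _; first by rewrite subrr normr0.
  by rewrite ler_wpM2l// invr_ge0.
have uS k : u k.+1 - u k = w - Phi (u k).
  by rewrite /u iterS /T addrAC subrr add0r.
have ustep k : `|u k.+1 - u k| <= s / 2 ^+ k.
  elim: k => [|k IH]; first by rewrite uS expr0 divr1.
  have -> : u k.+2 - u k.+1 = u k.+1 - u k - (Phi (u k.+1) - Phi (u k)).
    by rewrite !uS; apply/rowP => i; rewrite !mxE; ring.
  apply: le_trans (ctr _ _ (uball _) (uball _)) _.
  by rewrite exprS invfM mulrCA ler_wpM2l// invr_ge0.
have [hlim hzero] := HK.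
have /choice[l Hl] : forall j, exists l, forall k, `|l - u k 0 j| <= 4 * s / 2 ^+ k.
  move=> j; apply: hlim => k; apply: le_trans (ustep k).
  by have := mxnorm_entry (u k.+1 - u k) 0 j; rewrite !mxE.
pose y : 'rV[K]_N := \row_j l j.
have ylim k : `|y - u k| <= 4 * s / 2 ^+ k.
  apply: mxnorm_le => [|i j]; first by rewrite divr_ge0 ?mulr_ge0// exprn_ge0.
  by rewrite !mxE ord1.
have yx : `|y - x| <= 4 * s by have := ylim 0%N; rewrite expr0 divr1.
exists y => //.
apply/esym/eqP; rewrite -subr_eq0; apply/eqP/rowP => j; rewrite [RHS]mxE.
apply: (hzero _ (s + 2 * (4 * s))) => k.
apply: le_trans (mxnorm_entry _ 0 j) _.
have -> : w - Phi y = (u k.+1 - u k) + ((y - u k - (Phi y - Phi (u k))) - (y - u k)).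
  by rewrite uS; apply/rowP => i; rewrite !mxE; ring.
apply: le_trans (ler_normD _ _) _; rewrite mulrDl lerD//.
apply: le_trans (ler_normB _ _) _.
rewrite -mulrA [2 * _]mulr_natl mulr2n lerD//.
apply: le_trans (ctr _ _ (le_trans yx srho) (uball k)) _.
apply: le_trans (ylim k); rewrite ler_piMl//.
by rewrite invf_le1// ler1n.
Qed.

(** Row vectors are acted upon from the right, so [Q y y] is the transpose of
    the Jacobian matrix of [Phi] at y. *)
Definition has_slope N M (Phi : 'rV[K]_N -> 'rV[K]_M)
    (Q : 'rV[K]_N -> 'rV[K]_N -> 'M[K]_(N, M)) : Prop :=
  (forall y z, Phi y - Phi z = (y - z) *m Q y z) /\
  (forall i j, continuous (fun u : 'rV[K]_N * 'rV[K]_N => Q u.1 u.2 i j)).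

(** Continuity of the difference quotients gives strict differentiability,
    uniformly in both points. *)
Lemma slope_near N M Phi (Q : 'rV[K]_N -> 'rV[K]_N -> 'M[K]_(N, M)) :
  has_slope Phi Q -> forall (y0 z0 : 'rV[K]_N) (c : K), 0 < c ->
  exists2 rho : K, 0 < rho & forall y z : 'rV[K]_N, `|y - y0| < rho -> `|z - z0| < rho ->
    forall v : 'rV[K]_N, `|v *m (Q y z - Q y0 z0)| <= c * `|v|.
Proof.
move=> [_ Qc] y0 z0 c c0.
pose e := c / N.+1%:R.
have e0 : 0 < e by rewrite divr_gt0.
have : \forall u \near (y0, z0), forall ij : 'I_N * 'I_M,
    `|Q y0 z0 ij.1 ij.2 - Q u.1 u.2 ij.1 ij.2| < e.
  have F : Filter (nbhs ((y0, z0) : 'rV[K]_N * 'rV[K]_N)) by exact: nbhs_filter.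
  apply: (@filter_forall _ _ (fun (ij : 'I_N * 'I_M) (u : 'rV[K]_N * 'rV[K]_N) =>
    `|Q y0 z0 ij.1 ij.2 - Q u.1 u.2 ij.1 ij.2| < e) _ F) => -[i j] /=.
  by have /cvgrPdist_lt/(_ e e0) := Qc i j (y0, z0).
case=> -[A B] /= [/nbhs_normP[a /= a0 aA] /nbhs_normP[b /= b0 bB]] AB.
have [rho rho0 [ra rb]] := pos_lower_bound a0 b0.
exists rho => // y z yr zr v.
apply: le_trans (@mulmx_norm _ _ _ v _ e (ltW e0) _) _.
  move=> i j; rewrite !mxE distrC; apply/ltW; apply: (AB (y, z) _ (i, j)).
  split => /=; [apply: aA|apply: bB] => /=; rewrite distrC.
    exact: lt_le_trans ra.
  exact: lt_le_trans rb.
rewrite ler_wpM2r// /e mulrA ler_pdivrMr// mulrC ler_wpM2l ?ler_nat//.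
exact: ltW.
Qed.

End LocalInverse.

(** * The projection of a solution set near a point *)

Section Selection.
Variables (K : fieldType) (q m k : nat) (s : 'I_k -> 'I_q).

(** The matrix extracting from a row vector of length q + m the coordinates
    listed by s among the first q. *)
Definition sel_mx : 'M[K]_(q + m, k) := col_mx (colsub s 1%:M) 0.

Lemma mul_sel_mx (v : 'rV[K]_(q + m)) : v *m sel_mx = colsub s (lsubmx v).
Proof.
by rewrite -{1}[v]hsubmxK mul_row_col mulmx0 addr0 mulmx_colsub mulmx1.
Qed.

End Selection.

Lemma ge0_eps_eq0 (K : numFieldType) (a c : K) :
  0 <= a -> 0 <= c -> (forall e, 0 < e -> a <= c * e) -> a = 0.
Proof.
move=> a0 c0 H; apply/eqP; rewrite eq_le a0 andbT.
apply/ler_addgt0Pr => e e0; rewrite add0r.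
have c1 : 0 < c + 1 by rewrite ltr_wpDl.
apply: le_trans (H (e / (c + 1)) _) _; first by rewrite divr_gt0.
by rewrite mulrA ler_pdivrMr// mulrC ler_wpM2l ?lerDl// ltW.
Qed.

(** The solution set of f = 0 in a product of two affine spaces is projected to
    the first factor, near a zero x of f.  The coordinates selected by s on the
    first factor complete the equations to a square system whose Jacobian at x
    is invertible. *)
Section LocalImage.
Variable K : numFieldType.
Hypothesis HK : geom_complete K.
Variables (q m e k : nat) (f : 'rV[K]_(q + m) -> 'rV[K]_e).
Variable Qf : 'rV[K]_(q + m) -> 'rV[K]_(q + m) -> 'M[K]_(q + m, e).
Variable s : 'I_k -> 'I_q.
Variables (U : set 'rV[K]_q) (x : 'rV[K]_(q + m)).
Hypothesis fQ : has_slope f Qf.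
Hypothesis fx0 : f x = 0.
Hypothesis Ux : nbhs (lsubmx x) U.
Hypothesis kerx : forall v : 'rV[K]_(q + m),
  v *m Qf x x = 0 -> colsub s (lsubmx v) = 0 -> v = 0.
Hypothesis dimE : (e + k = q + m)%N.

Local Notation V := 'rV[K]_(q + m).

Let S : 'M[K]_(q + m, k) := sel_mx K m s.
(* the augmented system and its difference quotients *)
Let G (y : V) : 'rV[K]_(e + k) := row_mx (f y) (colsub s (lsubmx y)).
Let Q (y z : V) : 'M[K]_(q + m, e + k) := row_mx (Qf y z) S.

Lemma aug_slope : has_slope G Q.
Proof.
have [fE Qc] := fQ; split.
- move=> y z; rewrite /G /Q mul_mx_row opp_row_mx add_row_mx -fE mul_sel_mx.
  by congr (row_mx _ _); rewrite -!mul_sel_mx -mulmxBl.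
- move=> i j; case: (split_ordP j) => l jE.
    have -> : (fun u : V * V => Q u.1 u.2 i j) = (fun u => Qf u.1 u.2 i l).
      by apply/funext => u; rewrite jE /Q row_mxEl.
    exact: Qc.
  have -> : (fun u : V * V => Q u.1 u.2 i j) = cst (S i l).
    by apply/funext => u; rewrite jE /Q row_mxEr.
  exact: cst_continuous.
Qed.

Lemma aug_inverse : exists M : 'M[K]_(e + k, q + m),
  Q x x *m M = 1%:M /\ M *m Q x x = 1%:M.
Proof.
have Qfree : row_free (Q x x).
  apply: inj_row_free => v; rewrite /Q mul_mx_row -row_mx0 => /eq_row_mx[v1 v2].
  by apply: kerx => //; rewrite -mul_sel_mx.
have Qfull : row_full (Q x x) by rewrite /row_full (eqP Qfree) -dimE.
have /row_freeP[M QM] := Qfree; have /row_fullP[M' MQ] := Qfull.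
exists M; split => //.
by rewrite -[M]mul1mx -MQ -[_ *m M]mulmxA QM mulmx1.
Qed.

Lemma slope_rank : \rank (Qf x x) = e.
Proof.
have [M [_ MQ]] := aug_inverse.
suff : row_full (Qf x x) by move/eqP.
apply/row_fullP; exists (usubmx M).
have -> : Qf x x = lsubmx (Q x x) by rewrite row_mxKl.
rewrite mul_usub_mx mulmx_lsub MQ; apply/matrixP => i j.
by rewrite !mxE (inj_eq (@lshift_inj _ _)).
Qed.

Section Normalised.
Variable M : 'M[K]_(e + k, q + m).
Hypotheses (QM : Q x x *m M = 1%:M) (MQ : M *m Q x x = 1%:M).
Variable cM : K.
Hypotheses (cM0 : 0 < cM) (cMP : forall v : 'rV[K]_(e + k), `|v *m M| <= cM * `|v|).

Let Phi (y : V) : V := G y *m M.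

(** Composed with the inverse of its derivative at x, the augmented system has
    difference quotients close to the identity. *)
Lemma near_identity : exists2 rho : K, 0 < rho &
  forall y z : V, `|y - x| < rho -> `|z - x| < rho ->
  forall v : V, `|v *m (Q y z *m M) - v| <= 2^-1 * `|v|.
Proof.
have c0 : 0 < (2 * cM)^-1 by rewrite invr_gt0 mulr_gt0.
have [rho rho0 H] := slope_near aug_slope x x c0.
exists rho => // y z yr zr v.
have -> : v *m (Q y z *m M) - v = v *m (Q y z - Q x x) *m M.
  by rewrite -mulmxA mulmxBl QM mulmxBr mulmx1.
apply: le_trans (cMP _) _.
apply: (@le_trans _ _ (cM * ((2 * cM)^-1 * `|v|))).
  by rewrite ler_wpM2l ?(ltW cM0)// H.
by rewrite invfM -mulrA mulrCA mulVKf ?gt_eqF.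
Qed.

Section Ball.
Variable rho : K.
Hypotheses (rho0 : 0 < rho).
Hypothesis rhoP : forall y z : V, `|y - x| < rho -> `|z - x| < rho ->
  forall v : V, `|v *m (Q y z *m M) - v| <= 2^-1 * `|v|.

Lemma PhiB (y z : V) : Phi y - Phi z = (y - z) *m (Q y z *m M).
Proof. by rewrite /Phi -mulmxBl (aug_slope.1 y z) mulmxA. Qed.

Lemma Phi_contr (y z : V) : `|y - x| < rho -> `|z - x| < rho ->
  `|y - z - (Phi y - Phi z)| <= 2^-1 * `|y - z|.
Proof. by move=> yr zr; rewrite distrC PhiB rhoP. Qed.

Lemma Phi_expand (y z : V) : `|y - x| < rho -> `|z - x| < rho ->
  `|y - z| <= 2 * `|Phi y - Phi z|.
Proof.
move=> yr zr; have := Phi_contr yr zr.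
set a := y - z; set b := Phi y - Phi z => ab.
have : `|a| <= 2^-1 * `|a| + `|b|.
  by rewrite -{1}[a](subrK b) (le_trans (ler_normD _ _))// lerD2r.
rewrite -lerBlDl -{1}[`|a|]mul1r -mulrBl (_ : 1 - 2^-1 = 2^-1); last by field.
by rewrite ler_pdivrMl.
Qed.

(** The only fact about the branch needed for the upper bound: two nearby points
    are no further apart than a multiple of the distance of their images under
    the augmented system. *)
Lemma aug_expand (y z : V) : `|y - x| < rho -> `|z - x| < rho ->
  `|y - z| <= 2 * cM * `|G y - G z|.
Proof.
move=> yr zr; apply: le_trans (Phi_expand yr zr) _.
by rewrite -mulrA ler_wpM2l// /Phi -mulmxBl.
Qed.

(** An immersion into the projected branch stays one after projection to the k
    selected coordinates. *)
Lemma local_image_upper (W : set V) d :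
  W `<=` [set y | `|y - x| < rho] ->
  contains_submanifold (lsubmx @` ([set y : V | U (lsubmx y) /\ f y = 0] `&` W)) d ->
  (d <= k)%N.
Proof.
move=> Wrho [D [phi [Dopen [u0 Du0] phid phiD]]].
have [dphi injphi] := phid _ Du0.
set A := 'd phi u0 in injphi.
pose C := 2 * cM.
have C0 : 0 <= C by rewrite mulr_ge0// ltW.
pose X := lsubmx @` ([set y : V | U (lsubmx y) /\ f y = 0] `&` W).
(* f vanishes at the lifts of both points, only the selected coordinates remain *)
have key : \forall h \near (0 : 'rV[K]_d),
    `|phi (h + u0) - phi u0| <= C * `|colsub s (phi (h + u0) - phi u0)|.
  have := open_shift Dopen Du0; apply: filterS => h Dh.
  have [y [[_ fy] Wy] <-] : X (phi (h + u0)) by apply: phiD; exists (h + u0).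
  have [z [[_ fz] Wz] <-] : X (phi u0) by apply: phiD; exists u0.
  have -> : lsubmx y - lsubmx z = lsubmx (y - z) by rewrite linearB.
  apply: le_trans (lsubmx_norm _) _.
  apply: le_trans (aug_expand (Wrho _ Wy) (Wrho _ Wz)) _.
  rewrite ler_wpM2l// /G fy fz opp_row_mx add_row_mx subr0.
  by rewrite (le_trans (row_mx0_norm _ _))// -!mul_sel_mx -mulmxBl.
have kerA (v : 'rV[K]_d) : colsub s (A v) = 0 -> v = 0.
  move=> sAv; apply: injphi; rewrite linear0; apply/eqP; rewrite -normr_eq0.
  apply/eqP/(@ge0_eps_eq0 _ _ ((1 + C) * `|v|)) => // [|eps eps0].
    by rewrite mulr_ge0// addr_ge0.
  have : \forall h \near (0 : 'rV[K]_d),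
      `|phi (h + u0) - phi u0| <= C * `|colsub s (phi (h + u0) - phi u0)| /\
      `|phi (h + u0) - phi u0 - A h| <= eps * `|h|.
    by apply: filterS2 key (diff_estimate dphi eps0) => h h1 h2; split.
  move=> /nbhs_normP[r /= r0 rH].
  (* any t with |t v| < r would do; adding 1 covers v = 0 *)
  pose t := r / (2 * (`|v| + 1)).
  have v1 : 0 < `|v| + 1 by rewrite ltr_wpDl.
  have t0 : 0 < t by rewrite divr_gt0// mulr_gt0.
  have [|h1 h2] := rH (t *: v).
    rewrite /= sub0r normrN normrZ gtr0_norm// /t mulrAC ltr_pdivrMr ?mulr_gt0//.
    rewrite ltr_pM2l// mulr_natl mulr2n.
    by apply: ltr_wpDl; [exact: ltW | rewrite ltrDl].
  rewrite -/A in h2; set Delta := phi (t *: v + u0) - phi u0 in h1 h2.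
  have sD : `|colsub s Delta| <= eps * `|t *: v|.
    have -> : colsub s Delta = colsub s (Delta - A (t *: v)).
      rewrite linearZ /= [RHS]raddfB/= (_ : colsub s (t *: A v) = 0) ?subr0//.
      by rewrite -[LHS]/(mxsub id s _) linearZ/= -/(colsub s (A v)) sAv scaler0.
    exact: le_trans (colsub_norm _ _) _.
  have : `|A (t *: v)| <= (1 + C) * eps * `|t *: v|.
    have -> : A (t *: v) = Delta - (Delta - A (t *: v)).
      by rewrite opprB addrC subrK.
    apply: le_trans (ler_normB _ _) _.
    rewrite -mulrA mulrDl mul1r addrC lerD//.
    by apply: le_trans h1 _; rewrite ler_wpM2l.
  rewrite linearZ/= (normrZ t (A v)) (normrZ t v) mulrCA ler_pM2l ?normr_gt0 ?gt_eqF//.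
  by rewrite mulrAC.
pose B := lin1_mx A *m colsub s 1%:M.
have BE (v : 'rV[K]_d) : v *m B = colsub s (A v).
  by rewrite mulmxA mul_rV_lin1 mulmx_colsub mulmx1.
have : row_free B by apply: inj_row_free => v; rewrite BE; exact: kerA.
by move=> /eqP <-; exact: rank_leq_col.
Qed.

(** The local inverse of the augmented system, restricted to the points where
    the equations take the value 0, parametrises the branch. *)
Lemma local_image_lower (W : set V) : nbhs x W ->
  contains_submanifold (lsubmx @` ([set y : V | U (lsubmx y) /\ f y = 0] `&` W)) k.
Proof.
move=> nW.
have nU : \forall y \near x, U (lsubmx y).
  have /nbhs_normP[r /= r0 rU] := Ux.
  apply/nbhs_normP; exists r => //= y /= yr; apply: rU => /=.
  by apply: le_lt_trans yr; rewrite -linearB; exact: lsubmx_norm.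
have : \forall y \near x, W y /\ U (lsubmx y).
  by apply: filterS2 nW nU => y Wy Uy; split.
move=> /nbhs_normP[r1 /= r10 r1W].
have [r2 r20 [r21 r2rho]] := pos_lower_bound r10 rho0.
pose r := r2 / 2.
have r0 : 0 < r by rewrite divr_gt0.
have rr2 : r < r2 by rewrite ltr_pdivrMr// ltr_pMr// ltr1n.
have rrho y : `|y - x| <= r -> `|y - x| < rho.
  by move=> yr; apply: lt_le_trans r2rho; apply: le_lt_trans rr2.
pose u0 := colsub s (lsubmx x).
pose w (u : 'rV[K]_k) : V := row_mx (0 : 'rV[K]_e) u *m M.
have w0 : Phi x = w u0 by rewrite /Phi /G fx0.
have wB u u' : w u - w u' = row_mx (0 : 'rV[K]_e) (u - u') *m M.
  by rewrite /w -mulmxBl opp_row_mx add_row_mx subr0.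
have wBle u u' : `|w u - w u'| <= cM * `|u - u'|.
  by rewrite wB (le_trans (cMP _))// ler_wpM2l ?(ltW cM0)// row_mx0_norm.
(* 4 and r are those of contraction_surj, cM turns a bound on u into one on w u *)
pose delta := r / (4 * cM).
have delta0 : 0 < delta by rewrite divr_gt0// mulr_gt0.
pose D : set 'rV[K]_k := ball u0 delta.
have /choice[psi Hpsi] : forall u, exists y : V, D u -> `|y - x| <= r /\ Phi y = w u.
  move=> u; have [Du|nDu] := pselect (D u); last by exists 0.
  have wr : 4 * `|w u - Phi x| <= r.
    rewrite w0; move: Du; rewrite /D -ball_normE /= /delta ltr_pdivlMr ?mulr_gt0//.
    move=> /ltW; apply: le_trans; rewrite [leRHS]mulrC -mulrA ler_wpM2l// distrC.
    exact: wBle.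
  have [|y yx yw] := contraction_surj HK (rho := r) _ wr.
    by move=> y z yr zr; apply: Phi_contr; exact: rrho.
  by exists y => _; split => //; exact: le_trans wr.
have psiG u : D u -> G (psi u) = row_mx 0 u.
  by move=> /Hpsi[_ /(congr1 (mulmx^~ (Q x x)))]; rewrite /Phi /w -!mulmxA MQ !mulmx1.
have psif u : D u -> f (psi u) = 0 by move=> /psiG /eq_row_mx[].
exists D, (fun u => lsubmx (psi u)); split.
- exact: ball_open.
- by exists u0; exact: ballxx.
- move=> u Du.
  pose y0 := psi u; pose B := Q y0 y0 *m M.
  have y0rho : `|y0 - x| < rho by apply: rrho; exact: (Hpsi u Du).1.
  (* v = v - v B has norm at most |v| / 2 when v B = 0 *)
  have Bunit : B \in unitmx.
    rewrite -row_free_unit; apply: inj_row_free => v vB.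
    have := rhoP y0rho y0rho v; rewrite -/B vB sub0r normrN => vle.
    apply/eqP; rewrite -normr_eq0 eq_le normr_ge0 andbT.
    move: vle; rewrite -subr_le0 -{1}[`|v|]mul1r -mulrBl.
    rewrite (_ : 1 - 2^-1 = 2^-1); last by field.
    by rewrite pmulr_rle0// invr_gt0.
  (* the derivative of the parametrisation at u, acting on rows from the right *)
  pose L : 'M[K]_(k, q) := lsubmx (row_mx (0 : 'M[K]_(k, e)) 1%:M *m M *m invmx B).
  have LE (h : 'rV[K]_k) :
      h *m L = lsubmx (row_mx (0 : 'rV[K]_e) h *m M *m invmx B).
    by rewrite /L mulmx_lsub !mulmxA mul_mx_row mulmx0 mulmx1.
  have [cL cL0 cLP] := mulmx_bounded L.
  have Lcont : continuous (mulmxr L : 'rV[K]_k -> 'rV[K]_q).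
    by apply: (@bounded_linear_cts _ _ _ (mulmxr L) cL (ltW cL0)).
  have [cB cB0 cBP] := mulmx_bounded (M *m invmx B).
  have [dphi dphiE] : differentiable (fun u => lsubmx (psi u)) u /\
      'd (fun u => lsubmx (psi u)) u = mulmxr L :> ('rV[K]_k -> 'rV[K]_q).
    apply: differentiable_diff => // eps eps0.
    pose c := eps / (cB * (2 * cM)).
    have c0 : 0 < c by rewrite divr_gt0// !mulr_gt0.
    have [r3 r30 r3P] := slope_near aug_slope y0 y0 c0.
    have Dh : \forall h \near (0 : 'rV[K]_k), D (h + u).
      by apply: open_shift => //; exact: ball_open.
    have sh : \forall h \near (0 : 'rV[K]_k), 2 * cM * `|h| < r3.
      apply/nbhs_normP; exists (r3 / (2 * cM)) => /=; first by rewrite divr_gt0// mulr_gt0.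
      move=> h; rewrite /= sub0r normrN ltr_pdivlMr ?mulr_gt0// mulrC.
      exact.
    apply: filterS2 Dh sh => h Dh hr3.
    pose y := psi (h + u); pose dl := y - y0.
    have yrho : `|y - x| < rho by apply: rrho; exact: (Hpsi _ Dh).1.
    have PhiD : Phi y - Phi y0 = row_mx (0 : 'rV[K]_e) h *m M.
      by rewrite (Hpsi _ Dh).2 (Hpsi _ Du).2 wB addrK.
    have dlE : dl *m (Q y y0 *m M) = row_mx (0 : 'rV[K]_e) h *m M by rewrite -PhiB.
    have dlle : `|dl| <= 2 * cM * `|h|.
      apply: le_trans (Phi_expand yrho y0rho) _; rewrite -mulrA ler_wpM2l// PhiD.
      by rewrite (le_trans (cMP _))// ler_wpM2l ?(ltW cM0)// row_mx0_norm.
    have -> : lsubmx (psi (h + u)) - lsubmx (psi u) - mulmxr L h =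
        lsubmx (- (dl *m (Q y y0 - Q y0 y0)) *m (M *m invmx B)).
      have dldef : psi (h + u) - psi u = dl by [].
      clearbody dl.
      have e1 : dl *m Q y0 y0 *m (M *m invmx B) = dl.
        by rewrite mulmxA -[_ *m M]mulmxA mulmxK.
      rewrite [mulmxr L h]LE -dlE -!linearB /= dldef [dl *m (Q y y0 - _)]mulmxBr.
      by rewrite opprB mulmxBl e1 !mulmxA.
    apply: le_trans (lsubmx_norm _) _; apply: le_trans (cBP _) _.
    rewrite normrN.
    apply: (@le_trans _ _ (cB * (c * (2 * cM * `|h|)))).
      rewrite ler_wpM2l ?(ltW cB0)//; apply: le_trans (r3P _ _ _ _ _) _ => //.
      - exact: le_lt_trans hr3.
      - by rewrite subrr normr0.
      - by rewrite ler_wpM2l ?(ltW c0).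
    have nz : cB * (2 * cM) != 0 by rewrite gt_eqF// !mulr_gt0.
    have -> : cB * (c * (2 * cM * `|h|)) = c * (cB * (2 * cM)) * `|h| by ring.
    by rewrite /c divfK.
  (* injectivity: the selected coordinates of the vector v below are the increment h *)
  split => // h1 h2; rewrite dphiE /= => /eqP; rewrite -subr_eq0 -mulmxBl => /eqP.
  set h := h1 - h2; rewrite LE => h0.
  apply/eqP; rewrite -subr_eq0 -/h; apply/eqP.
  move: h0; set v := _ *m invmx B => v0.
  have vB : v *m B = row_mx (0 : 'rV[K]_e) h *m M by rewrite /v mulmxKV.
  have : v *m Q y0 y0 = row_mx 0 h.
    by move: vB => /(congr1 (mulmx^~ (Q x x))); rewrite /B -!mulmxA MQ !mulmx1.
  rewrite /Q mul_mx_row => /eq_row_mx[_]; rewrite mul_sel_mx v0 => <-.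
  by apply/matrixP => i j; rewrite !mxE.
- move=> _ [u Du <-]; exists (psi u) => //.
  have [yx _] := Hpsi _ Du.
  have [] := r1W (psi u).
    by rewrite /= distrC; apply: le_lt_trans yx _; apply: lt_le_trans r21.
  by move=> Wy Uy; split => //; split => //; exact: psif.
Qed.

End Ball.
End Normalised.

(** Near a zero x of f where the augmented Jacobian is invertible, the
    projection of the solution set has dimension k, the number of selected
    coordinates, hence codimension q - k in the first factor. *)
Theorem local_image_codim r : (k + r = q)%N ->
  exists2 W0 : set V, nbhs x W0 & forall W : set V, nbhs x W -> W `<=` W0 ->
    has_codim (lsubmx @` ([set y : V | U (lsubmx y) /\ f y = 0] `&` W)) r.
Proof.
move=> krq.
have [M [QM MQ]] := aug_inverse; have [cM cM0 cMP] := mulmx_bounded M.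
have [rho rho0 rhoP] := near_identity QM cM0 cMP.
exists [set y | `|y - x| < rho].
  by apply/nbhs_ballP; exists rho => //= y; rewrite -ball_normE /= distrC.
move=> W nW Wrho; exists k => //; split.
  exact: (local_image_lower MQ cM0 cMP rho0 rhoP nW).
by move=> d; exact: (local_image_upper cM0 cMP rhoP Wrho).
Qed.

End LocalImage.

(** * Differentials of functions and of polynomials *)

Section HasDiff.
Variables (K : numFieldType) (N : nat).
Local Notation V := 'rV[K]_N.

(** [df y v] is the differential of f at y in the direction v.  The quotients
    q_i are required to be jointly continuous in both points, so this is
    continuous differentiability, and for polynomials it holds everywhere. *)
Definition has_diff (f : V -> K) (df : V -> V -> K) : Prop :=
  exists q : 'I_N -> V * V -> K,
  [/\ continuous f, forall i, continuous (q i),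
      forall y z : V, f y - f z = \sum_i (y 0 i - z 0 i) * q i (y, z)
    & forall y v : V, \sum_i v 0 i * q i (y, y) = df y v].

Lemma has_diff_cst (c : K) : has_diff (fun=> c) (fun _ _ => 0).
Proof.
exists (fun _ _ => 0); split => [|i|y z|y v]; try exact: cst_continuous.
- by rewrite subrr big1// => i _; rewrite mulr0.
- by rewrite big1// => i _; rewrite mulr0.
Qed.

Lemma has_diff_coord (j : 'I_N) : has_diff (fun y => y 0 j) (fun _ v => v 0 j).
Proof.
have E (x : V) : \sum_i x 0 i * (i == j)%:R = x 0 j.
  rewrite (bigD1 j)//= eqxx mulr1 big1 ?addr0// => i /negPf ->.
  by rewrite mulr0.
exists (fun i _ => (i == j)%:R); split => [|i|y z|y v]; try exact: cst_continuous.
- exact: coord_continuous.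
- by have := E (y - z); rewrite !mxE => <-; apply: eq_bigr => i _; rewrite !mxE.
- exact: E.
Qed.

Lemma has_diffD f df g dg : has_diff f df -> has_diff g dg ->
  has_diff (fun y => f y + g y) (fun y v => df y v + dg y v).
Proof.
move=> [p [fc pc pE pd]] [q [gc qc qE qd]].
exists (fun i u => p i u + q i u); split => [|i|y z|y v].
- by move=> y; apply: continuousD; [exact: fc|exact: gc].
- by move=> u; apply: continuousD; [exact: pc|exact: qc].
- rewrite opprD addrACA pE qE -big_split/=.
  by apply: eq_bigr => i _; rewrite mulrDr.
- by rewrite -pd -qd -big_split/=; apply: eq_bigr => i _; rewrite mulrDr.
Qed.

Lemma has_diffN f df : has_diff f df ->
  has_diff (fun y => - f y) (fun y v => - df y v).
Proof.
move=> [p [fc pc pE pd]]; exists (fun i u => - p i u); split => [|i|y z|y v].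
- by move=> y; apply: continuousN; exact: fc.
- by move=> u; apply: continuousN; exact: pc.
- by rewrite -opprD pE -sumrN; apply: eq_bigr => i _; rewrite mulrN.
- by rewrite -pd -sumrN; apply: eq_bigr => i _; rewrite mulrN.
Qed.

Lemma has_diffM f df g dg : has_diff f df -> has_diff g dg ->
  has_diff (fun y => f y * g y) (fun y v => df y v * g y + f y * dg y v).
Proof.
move=> [p [fc pc pE pd]] [q [gc qc qE qd]].
exists (fun i u => p i u * g u.2 + f u.1 * q i u); split => [|i|y z|y v].
- by move=> y; apply: continuousM; [exact: fc|exact: gc].
- move=> u; apply: cvgD; apply: cvgM.
  + exact: pc.
  + by apply: (cvg_comp snd g); [exact: cvg_snd | exact: gc].
  + by apply: (cvg_comp fst f); [exact: cvg_fst | exact: fc].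
  + exact: qc.
- have -> : f y * g y - f z * g z = (f y - f z) * g z + f y * (g y - g z) by ring.
  rewrite pE qE mulr_suml mulr_sumr -big_split/=.
  by apply: eq_bigr => i _; ring.
- rewrite -pd -qd mulr_suml mulr_sumr -big_split/=.
  by apply: eq_bigr => i _; ring.
Qed.

Lemma has_diff_sum (I : Type) (r : seq I) (f : I -> V -> K) df :
  (forall i, has_diff (f i) (df i)) ->
  has_diff (fun y => \sum_(i <- r) f i y) (fun y v => \sum_(i <- r) df i y v).
Proof.
move=> H; elim: r => [|i r IH].
  have := has_diff_cst 0; congr (has_diff _ _).
    by apply/funext => y; rewrite big_nil.
  by apply/funext => y; apply/funext => v; rewrite big_nil.
have := has_diffD (H i) IH; congr (has_diff _ _).
  by apply/funext => y; rewrite big_cons.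
by apply/funext => y; apply/funext => v; rewrite big_cons.
Qed.

Lemma has_diff_derive f df x v : has_diff f df -> 'D_v f x = df x v.
Proof.
move=> [p [fc pc pE pd]]; apply: cvg_lim => //.
have C : (fun h : K => \sum_i v 0 i * p i (h *: v + x, x)) @ (0 : K)^' --> df x v.
  rewrite -pd; apply: cvg_big => [|i _]; first exact: add_continuous.
  apply: cvgM; first exact: cvg_cst.
  apply: (cvg_comp (fun h : K => (h *: v + x, x)) (p i)); last exact: pc.
  apply: (@cvg_pair _ _ _ (0 : K)^' (nbhs x) (nbhs x)); last exact: cvg_cst.
  have : (h *: v + x) @[h --> nbhs (0 : K)] --> x.
    rewrite -[X in _ --> X](add0r x) -(scale0r v).
    by apply: cvgD; [exact: (@scalel_continuous K V v 0) | exact: cvg_cst].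
  by apply: cvg_trans; apply: cvg_app; exact: nbhs_dnbhs.
apply: cvg_trans C; apply: near_eq_cvg; near=> h.
have h0 : h != 0 by near: h; exact: nbhs_dnbhs_neq.
rewrite /= pE scaler_sumr; apply: eq_bigr => i _.
by rewrite !mxE addrK -mulrA -[RHS]/(_ * _) mulKf.
Unshelve. all: by end_near.
Qed.

End HasDiff.

Lemma has_diff_slope (K : numFieldType) N M (f : 'rV[K]_N -> 'rV[K]_M)
    (df : 'rV[K]_N -> 'rV[K]_N -> 'rV[K]_M) :
  (forall j, has_diff (fun y => f y 0 j) (fun y v => df y v 0 j)) ->
  exists2 Q, has_slope f Q & forall y v, v *m Q y y = df y v.
Proof.
move=> /choice[q Hq].
exists (fun y z => \matrix_(i, j) q j i (y, z)).
  split => [y z|i j].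
    apply/rowP => j; rewrite !mxE; have [_ _ -> _] := Hq j.
    by apply: eq_bigr => i _; rewrite !mxE.
  have [_ qc _ _] := Hq j.
  have -> : (fun u : 'rV[K]_N * 'rV[K]_N => (\matrix_(i, j) q j i (u.1, u.2)) i j) = q j i.
    by apply/funext => -[y z]; rewrite mxE.
  exact: qc.
move=> y v; apply/rowP => j; rewrite !mxE; have [_ _ _ <-] := Hq j.
by apply: eq_bigr => i _; rewrite !mxE.
Qed.

Section PolyDiff.
Variables (K : numFieldType) (N : nat).
Local Notation V := 'rV[K]_N.
Local Notation PP := {poly {poly K}}.

(** Differentiability of a family of bivariate polynomials, coefficient by
    coefficient; no degree bound is needed. *)
Definition has_pdiff (F : V -> PP) (dF : V -> V -> PP) : Prop :=
  forall a b, has_diff (fun y => (F y)`_a`_b) (fun y v => (dF y v)`_a`_b).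

Lemma has_pdiff_eq F dF F' dF' : (forall y, F y = F' y) ->
  (forall y v, dF y v = dF' y v) -> has_pdiff F dF -> has_pdiff F' dF'.
Proof.
move=> FE dFE H a b; have := H a b; congr (has_diff _ _).
  by apply/funext => y; rewrite FE.
by apply/funext => y; apply/funext => v; rewrite dFE.
Qed.

Lemma has_pdiff_cst (P : PP) : has_pdiff (fun=> P) (fun _ _ => 0).
Proof.
move=> a b; have := has_diff_cst N (P`_a`_b); congr (has_diff _ _).
by apply/funext => y; apply/funext => v; rewrite !coef0.
Qed.

Lemma has_pdiff_constp f df : has_diff f df ->
  has_pdiff (fun y => constp (f y)) (fun y v => constp (df y v)).
Proof.
move=> H a b.
have E c : (constp c : PP)`_a`_b = if (a == 0%N) && (b == 0%N) then c else 0.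
  by rewrite /constp coefC; case: (a == 0%N); [rewrite coefC | rewrite coef0].
have -> : (fun y => (constp (f y) : PP)`_a`_b) =
    fun y => if (a == 0%N) && (b == 0%N) then f y else 0.
  by apply/funext => y; rewrite E.
have -> : (fun y v => (constp (df y v) : PP)`_a`_b) =
    fun y v => if (a == 0%N) && (b == 0%N) then df y v else 0.
  by apply/funext => y; apply/funext => v; rewrite E.
by case: ((a == 0%N) && (b == 0%N)) => //; exact: has_diff_cst.
Qed.

Lemma has_pdiffD F dF G dG : has_pdiff F dF -> has_pdiff G dG ->
  has_pdiff (fun y => F y + G y) (fun y v => dF y v + dG y v).
Proof.
move=> HF HG a b; have := has_diffD (HF a b) (HG a b); congr (has_diff _ _).
  by apply/funext => y; rewrite !coefD.
by apply/funext => y; apply/funext => v; rewrite !coefD.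
Qed.

Lemma has_pdiffN F dF : has_pdiff F dF ->
  has_pdiff (fun y => - F y) (fun y v => - dF y v).
Proof.
move=> HF a b; have := has_diffN (HF a b); congr (has_diff _ _).
  by apply/funext => y; rewrite !coefN.
by apply/funext => y; apply/funext => v; rewrite !coefN.
Qed.

Lemma coefMM (P Q : PP) a b : (P * Q)`_a`_b =
  \sum_(j < a.+1) \sum_(l < b.+1) P`_j`_l * Q`_(a - j)`_(b - l).
Proof. by rewrite coefM coef_sum; apply: eq_bigr => j _; rewrite coefM. Qed.

Lemma has_pdiffM F dF G dG : has_pdiff F dF -> has_pdiff G dG ->
  has_pdiff (fun y => F y * G y) (fun y v => dF y v * G y + F y * dG y v).
Proof.
move=> HF HG a b.
have := has_diff_sum (index_enum 'I_a.+1) (fun j =>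
  has_diff_sum (index_enum 'I_b.+1) (fun l =>
    has_diffM (HF j l) (HG (a - j)%N (b - l)%N))).
congr (has_diff _ _).
  by apply/funext => y; rewrite coefMM.
apply/funext => y; apply/funext => v.
rewrite !coefD !coefMM -big_split/=; apply: eq_bigr => j _.
by rewrite -big_split.
Qed.

Lemma has_pdiff_sum (I : Type) (r : seq I) (F : I -> V -> PP) dF :
  (forall i, has_pdiff (F i) (dF i)) ->
  has_pdiff (fun y => \sum_(i <- r) F i y) (fun y v => \sum_(i <- r) dF i y v).
Proof.
move=> H a b; have := has_diff_sum r (fun i => H i a b); congr (has_diff _ _).
  by apply/funext => y; rewrite !coef_sum.
by apply/funext => y; apply/funext => v; rewrite !coef_sum.
Qed.

Lemma has_pdiffMr F dF P : has_pdiff F dF ->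
  has_pdiff (fun y => F y * P) (fun y v => dF y v * P).
Proof.
move=> H; apply: has_pdiff_eq (has_pdiffM H (has_pdiff_cst P)) => // y v.
by rewrite mulr0 addr0.
Qed.

End PolyDiff.

Section ChainDiff.
Variable K : numFieldType.
Local Notation PP := {poly {poly K}}.

(** The differential of [Ppoly]. *)
Fixpoint dPpoly (a c da dc : nat -> K) (k : nat) : PP :=
  match k with
  | 0 => 0
  | k1.+1 =>
    match k1 with
    | 0 => constp (da 1%N)
    | k2.+1 => constp (da k) * Ppoly a c k1 + (lam K + constp (a k)) * dPpoly a c da dc k1
               - tvar K * (constp (dc k1) * Ppoly a c k2 + constp (c k1) * dPpoly a c da dc k2)
    end
  end.

Lemma dPpolySS a c da dc k : dPpoly a c da dc k.+2 =
  constp (da k.+2) * Ppoly a c k.+1 + (lam K + constp (a k.+2)) * dPpoly a c da dc k.+1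
  - tvar K * (constp (dc k.+1) * Ppoly a c k + constp (c k.+1) * dPpoly a c da dc k).
Proof. by []. Qed.

Lemma Ppoly_diff N (a c : 'rV[K]_N -> nat -> K) (da dc : 'rV[K]_N -> 'rV[K]_N -> nat -> K) :
  (forall k, has_diff (a^~ k) (fun y v => da y v k)) ->
  (forall k, has_diff (c^~ k) (fun y v => dc y v k)) ->
  forall k, has_pdiff (fun y => Ppoly (a y) (c y) k)
                      (fun y v => dPpoly (a y) (c y) (da y v) (dc y v) k).
Proof.
move=> ha hc k.
suff [] : has_pdiff (fun y => Ppoly (a y) (c y) k)
                      (fun y v => dPpoly (a y) (c y) (da y v) (dc y v) k) /\
   has_pdiff (fun y => Ppoly (a y) (c y) k.+1)
                      (fun y v => dPpoly (a y) (c y) (da y v) (dc y v) k.+1) by [].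
elim: k => [|k [IH1 IH2]]; split => //.
- exact: has_pdiff_cst.
- have hl := has_pdiffD (has_pdiff_cst N (lam K)) (has_pdiff_constp (ha 1%N)).
  by apply: has_pdiff_eq hl => // y v; rewrite add0r.
- have hl := has_pdiffD (has_pdiff_cst N (lam K)) (has_pdiff_constp (ha k.+2)).
  have ht := has_pdiffM (has_pdiff_cst N (tvar K)) (has_pdiff_constp (hc k.+1)).
  have hP := has_pdiffD (has_pdiffM hl IH2) (has_pdiffN (has_pdiffM ht IH1)).
  apply: has_pdiff_eq hP => // y v.
  by rewrite add0r mul0r add0r dPpolySS; ring.
Qed.

(** The differential of [Ppoly] is linear in the increments, of which only those
    with indices in 1..n, resp. 1..n-1, occur. *)
Lemma dPpoly_lin (I : Type) (r : seq I) (w : I -> K) (a c da dc : nat -> K)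
    (ea ec : I -> nat -> K) n :
  (forall k, (0 < k <= n)%N -> da k = \sum_(i <- r) w i * ea i k) ->
  (forall k, (0 < k < n)%N -> dc k = \sum_(i <- r) w i * ec i k) ->
  dPpoly a c da dc n = \sum_(i <- r) constp (w i) * dPpoly a c (ea i) (ec i) n.
Proof.
move=> Ha Hc.
have cE (x : I -> K) : constp (\sum_(i <- r) w i * x i) =
    \sum_(i <- r) constp (w i) * constp (x i) :> PP.
  by rewrite /constp !rmorph_sum; apply: eq_bigr => i _; rewrite !rmorphM.
pose P k := (k <= n)%N ->
  dPpoly a c da dc k = \sum_(i <- r) constp (w i) * dPpoly a c (ea i) (ec i) k.
(* two consecutive cases are proved together, as the recursion requires *)
suff H k : P k /\ P k.+1.
  by apply: (H n).1.
elim: k => [|k [IH1 IH2]]; split => //.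
- by move=> _; rewrite big1// => i _; rewrite mulr0.
- by move=> n1; rewrite /= Ha// cE.
move=> kn; have kn1 := ltnW kn.
rewrite dPpolySS Ha// Hc// !cE IH2// (IH1 (ltnW kn1)).
rewrite !mulr_suml !mulr_sumr -!big_split/= mulr_sumr -sumrN -big_split/=.
by apply: eq_bigr => i _; ring.
Qed.

End ChainDiff.

(** * Integer polynomials and elimination *)

Section ListPoly.
Variables (T : Type) (t0 : T) (tadd tmul : T -> T -> T).

(** Polynomials as lists of coefficients, constant term first. *)
Fixpoint ladd (l m : seq T) : seq T :=
  match l, m with
  | [::], _ => m
  | _, [::] => l
  | x :: l', y :: m' => tadd x y :: ladd l' m'
  end.

Fixpoint lmul (l m : seq T) : seq T :=
  if l is x :: l' then ladd [seq tmul x y | y <- m] (t0 :: lmul l' m) else [::].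

Variables (A : comNzRingType) (ev : T -> A).

Definition lev (l : seq T) : {poly A} := Poly (map ev l).

Lemma lev_cons x l : lev (x :: l) = (ev x)%:P + lev l * 'X.
Proof. by rewrite /lev /= cons_poly_def addrC. Qed.

Lemma lev_nil : lev [::] = 0. Proof. by []. Qed.

Hypothesis ev0 : ev t0 = 0.
Hypothesis evD : forall x y, ev (tadd x y) = ev x + ev y.
Hypothesis evM : forall x y, ev (tmul x y) = ev x * ev y.

Lemma lev_add l m : lev (ladd l m) = lev l + lev m.
Proof.
elim: l m => [|x l IH] [|y m]; rewrite ?lev_nil ?add0r ?addr0//.
by rewrite /= !lev_cons IH evD polyCD mulrDl addrACA.
Qed.

Lemma lev_mul l m : lev (lmul l m) = lev l * lev m.
Proof.
elim: l => [|x l IH]; first by rewrite lev_nil mul0r.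
rewrite /= lev_add !lev_cons ev0 add0r IH mulrDl mulrAC; congr (_ + _).
elim: m {IH} => [|y m IHm]; first by rewrite lev_nil mulr0.
by rewrite /= !lev_cons evM polyCM IHm mulrDr mulrA.
Qed.

Lemma lev_coef l i : (lev l)`_i = ev (nth t0 l i).
Proof.
rewrite /lev coef_Poly; have [il|il] := ltnP i (size l).
  by rewrite (nth_map t0).
by rewrite !nth_default ?size_map.
Qed.

Lemma lev_zero (z : pred T) l : (forall x, z x -> ev x = 0) -> all z l -> lev l = 0.
Proof.
move=> zE; elim: l => [|x l IH] //= /andP[zx zl].
by rewrite lev_cons zE// IH// mul0r addr0.
Qed.

End ListPoly.

(** Bivariate integer polynomials as lists of lists of binary integers; the
    outer list is indexed by the power of lambda, the inner ones by the power
    of t.  The representation is not unique: trailing zeros are allowed. *)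
Definition zpoly := seq (seq Z).
Definition zadd1 := ladd Z.add.
Definition zmul1 := lmul Z0 Z.add Z.mul.
Definition zadd : zpoly -> zpoly -> zpoly := ladd zadd1.
Definition zmul : zpoly -> zpoly -> zpoly := lmul [::] zadd1 zmul1.
Definition zconst (c : Z) : zpoly := [:: [:: c]].
Definition zopp (P : zpoly) : zpoly := zmul (zconst (Zneg 1)) P.
Definition zsub P Q := zadd P (zopp Q).
Definition zlam : zpoly := [:: [::]; [:: Zpos 1]].
Definition ztv : zpoly := [:: [:: Z0; Zpos 1]].
(** The monomial [lambda^i t^k]. *)
Definition zmonom (i k : nat) : zpoly := ncons i [::] [:: ncons k Z0 [:: Zpos 1]].
Definition zcoef (P : zpoly) (a b : nat) : Z := nth Z0 (nth [::] P a) b.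
Definition zzero (P : zpoly) : bool := all (all (Z.eqb Z0)) P.
Definition zeqp P Q := zzero (zsub P Q).

Section ZEval.
Variable K : numFieldType.
Local Notation PP := {poly {poly K}}.

(** The embedding of the binary integers into a field of characteristic 0. *)
Definition zK (z : Z) : K := (int_of_Z z)%:~R.

Lemma zK0 : zK Z0 = 0. Proof. by []. Qed.
Lemma zK1 : zK (Zpos 1) = 1. Proof. by []. Qed.
Lemma zKD x y : zK (Z.add x y) = zK x + zK y.
Proof. by rewrite /zK (raddfD int_of_Z) intrD. Qed.
Lemma zKM x y : zK (Z.mul x y) = zK x * zK y.
Proof. by rewrite /zK (rmorphM int_of_Z) intrM. Qed.
Lemma zKN x : zK (Z.opp x) = - zK x.
Proof. by rewrite /zK (raddfN int_of_Z) intrN. Qed.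
Lemma zK_eq0 x : (zK x == 0) = (x == Z0).
Proof.
rewrite /zK intr_eq0 -[X in _ = (_ == X)](int_of_ZK Z0).
by rewrite -(inj_eq (can_inj int_of_ZK)) Z_of_intK.
Qed.

(** The bivariate polynomial over K denoted by a list of lists. *)
Definition pev : zpoly -> PP := lev (lev zK).

Lemma pevD P Q : pev (zadd P Q) = pev P + pev Q.
Proof. by apply: lev_add => x y; apply: lev_add; exact: zKD. Qed.

Lemma pevM P Q : pev (zmul P Q) = pev P * pev Q.
Proof.
apply: lev_mul => [//|x y|x y].
  by apply: lev_add; exact: zKD.
by apply: lev_mul; [exact: zK0|exact: zKD|exact: zKM].
Qed.

Lemma pev_const c : pev (zconst c) = constp (zK c).
Proof. by rewrite /pev !lev_cons !lev_nil !mul0r !addr0. Qed.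

Lemma pevN P : pev (zopp P) = - pev P.
Proof. by rewrite pevM pev_const /constp (zKN (Zpos 1)) zK1 !polyCN mulN1r. Qed.

Lemma pevB P Q : pev (zsub P Q) = pev P - pev Q.
Proof. by rewrite pevD pevN. Qed.

Lemma pev_lam : pev zlam = lam K.
Proof. by rewrite /pev !lev_cons !lev_nil !mul0r zK1 !addr0 add0r mul1r. Qed.

Lemma pev_tv : pev ztv = tvar K.
Proof. by rewrite /pev !lev_cons !lev_nil zK0 zK1 !mul0r !addr0 add0r mul1r. Qed.

Lemma pev_monom i k : pev (zmonom i k) = tvar K ^+ k * lam K ^+ i.
Proof.
rewrite /zmonom; elim: i => [|i IH] /=.
  rewrite expr0 mulr1 /pev lev_cons lev_nil mul0r addr0 /tvar -rmorphXn; congr _%:P.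
  elim: k => [|k IH] /=; first by rewrite lev_cons lev_nil mul0r addr0.
  by rewrite lev_cons zK0 add0r IH exprSr.
by move: IH; rewrite /pev => IH; rewrite lev_cons lev_nil add0r IH exprSr mulrA.
Qed.

Lemma pev_coef P a b : (pev P)`_a`_b = zK (zcoef P a b).
Proof. by rewrite /pev (lev_coef (t0 := [::])) ?lev_nil// (lev_coef (t0 := Z0)). Qed.

Lemma zeqpP P Q : zeqp P Q -> pev P = pev Q.
Proof.
move=> PQ; apply/eqP; rewrite -subr_eq0 -pevB; apply/eqP.
apply: lev_zero PQ => l; apply: lev_zero => x /Z.eqb_eq <-; exact: zK0.
Qed.

End ZEval.

(** Scalar product of an integer row and a vector over K. *)
Fixpoint dot (K : numFieldType) (r : seq Z) (v : seq K) : K :=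
  match r, v with
  | x :: r', y :: v' => zK K x * y + dot r' v'
  | _, _ => 0
  end.

(** Division of a row by the gcd of its entries.  The result is used only if
    multiplying it back gives the row, so that nothing has to be known about
    gcds and integer division. *)
Definition primitive_row (r : seq Z) : seq Z :=
  let g := foldr Z.gcd Z0 r in
  let r' := [seq Z.div x g | x <- r] in
  if (g != Z0) && ([seq Z.mul g x | x <- r'] == r) then r' else r.

(** Fraction-free Gaussian elimination, one column at a time: when it succeeds,
    every vector of length n orthogonal to all the rows vanishes. *)
Fixpoint kertriv (n : nat) (rows : seq (seq Z)) : bool :=
  if n is n'.+1 then
    let nz := [seq r <- rows | head Z0 r != Z0] in
    let z := [seq r <- rows | head Z0 r == Z0] in
    if nz is p :: ps then
      kertriv n' ([seq primitive_row
          (zadd1 [seq Z.mul (head Z0 p) x | x <- behead r]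
                 [seq Z.mul (Z.opp (head Z0 r)) x | x <- behead p]) | r <- ps]
        ++ [seq behead r | r <- z])
    else false
  else true.

Section Elimination.
Variable K : numFieldType.

Lemma dot_scale c r (v : seq K) : dot [seq Z.mul c x | x <- r] v = zK K c * dot r v.
Proof.
elim: r v => [|x r IH] [|y v] //=; rewrite ?mulr0//.
by rewrite IH zKM mulrDr mulrA.
Qed.

Lemma dot_add r s (v : seq K) : dot (zadd1 r s) v = dot r v + dot s v.
Proof.
elim: r s v => [|x r IH] [|y s] [|z v] //=; rewrite ?add0r ?addr0//.
by rewrite -/zadd1 IH zKD mulrDl addrACA.
Qed.

Lemma dot_rev r (v : seq K) : size r = size v -> dot (rev r) (rev v) = dot r v.
Proof.
elim: r v => [|x r IH] [|y v] //= [rv]; rewrite !rev_cons -!cats1.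
have -> : forall (r1 : seq Z) (v1 : seq K), size r1 = size v1 ->
    dot (r1 ++ [:: x]) (v1 ++ [:: y]) = dot r1 v1 + zK K x * y.
  elim=> [|x1 r1 IH1] [|y1 v1] //= => [_|[/IH1 ->]]; first by rewrite addr0 add0r.
  by rewrite addrA.
- by rewrite IH// addrC.
- by rewrite !size_rev.
Qed.

Lemma dot_primitive r (v : seq K) : dot r v = 0 -> dot (primitive_row r) v = 0.
Proof.
rewrite /primitive_row; case: ifP => // /andP[g0 /eqP E]; rewrite -{1}E dot_scale.
by move=> /eqP; rewrite mulf_eq0 zK_eq0 (negPf g0) => /eqP.
Qed.

Lemma dot_head r y (v : seq K) : dot r (y :: v) = zK K (head Z0 r) * y + dot (behead r) v.
Proof. by case: r => [|x r] //=; rewrite zK0 mul0r addr0. Qed.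

Lemma kertrivP n rows (v : seq K) : kertriv n rows -> size v = n ->
  (forall r, r \in rows -> dot r v = 0) -> v = nseq n 0.
Proof.
elim: n rows v => [|n IH] rows [|y v] //=.
case E : [seq r <- rows | head Z0 r != Z0] => [//|p ps] Hk [sv] H.
have inp r : r \in p :: ps -> dot r (y :: v) = 0 /\ head Z0 r != Z0.
  by rewrite -E mem_filter => /andP[h /H].
have [p0 hp] := inp p (mem_head _ _).
have v0 : v = nseq n 0.
  apply: IH Hk sv _ => r; rewrite mem_cat => /orP[] /mapP[s].
    move=> sps ->; have [s0 hs] := inp s (mem_behead (s := p :: ps) sps).
    apply: dot_primitive; rewrite dot_add !dot_scale zKN.
    move: p0 s0; rewrite !dot_head => /eqP; rewrite addr_eq0 => /eqP p0 /eqP.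
    rewrite addr_eq0 => /eqP s0.
    have -> : dot (behead s) v = - (zK K (head Z0 s) * y) by rewrite s0 opprK.
    have -> : dot (behead p) v = - (zK K (head Z0 p) * y) by rewrite p0 opprK.
    ring.
  rewrite mem_filter => /andP[/eqP h /H s0] ->.
  by move: s0; rewrite dot_head h zK0 mul0r add0r.
congr (_ :: _) => //.
move: p0; rewrite dot_head v0.
have -> s : dot s (nseq n (0 : K)) = 0.
  by elim: s n {IH Hk sv v0 H} => [|x s IHs] [|n'] //=; rewrite IHs mulr0 addr0.
by rewrite addr0 => /eqP; rewrite mulf_eq0 zK_eq0 (negPf hp) => /eqP.
Qed.

End Elimination.

(** * The incidence equations and their differential *)

Section BoundedPoly.
Variable K : numFieldType.
Local Notation PP := {poly {poly K}}.

(** The index pairs of [bidx d] as a list of pairs of numbers; as there, the first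
    component is one less than the j of the coefficients. *)
Definition bpairs (d : nat) : seq (nat * nat) :=
  [seq (j, k) | j <- iota 0 d, k <- iota 0 (j.+1)./2.+1].

Lemma sum_bidx (M : nmodType) d (H : nat -> nat -> M) :
  \sum_(s : bidx d) H (tag s) (tagged s) = \sum_(p <- bpairs d) H p.1 p.2.
Proof.
transitivity (\sum_(j < d) \sum_(k < (j.+1)./2.+1) H j k).
  by rewrite (sig_big_dep _ _ (fun (j : 'I_d) (k : 'I_(j.+1)./2.+1) => H j k)).
have E m : iota 0 m = index_iota 0 m by rewrite /index_iota subn0.
rewrite big_allpairs_dep E big_mkord; apply: eq_bigr => j _.
by rewrite E big_mkord.
Qed.

Lemma card_bidx d : #|bidx d| = size (bpairs d).
Proof. by rewrite -sum1_card (sum_bidx d (fun _ _ => 1%N)) sum1_size. Qed.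

(** The index pair of [bpairs d] corresponding to an element of [bidx d]. *)
Definition bkey d (s : bidx d) : nat * nat := (tag s : nat, tagged s : nat).

Lemma bkey_inj d : injective (@bkey d).
Proof.
move=> [j k] [j' k'] [] /val_inj E; case: _ / E k' => k' /= E.
by congr existT; apply: val_inj.
Qed.

Lemma bkey_pairs d (s : bidx d) : bkey s \in bpairs d.
Proof.
by apply/allpairsPdep; exists (tag s : nat), (tagged s : nat); rewrite !mem_iota/=.
Qed.

(** The coefficient of [t^k lambda^(d-j-1)] for [p = (j, k)]. *)
Definition bval d (f : 'rV[K]_#|bidx d|) (p : nat * nat) : K :=
  if [pick s : bidx d | bkey s == p] is Some s then f 0 (enum_rank s) else 0.

Lemma bval_key d (f : 'rV[K]_#|bidx d|) s : bval f (bkey s) = f 0 (enum_rank s).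
Proof.
rewrite /bval; case: pickP => [s' /eqP /bkey_inj -> //|/(_ s)].
by rewrite eqxx.
Qed.

Lemma bval_eq0 d (f : 'rV[K]_#|bidx d|) :
  (forall p, p \in bpairs d -> bval f p = 0) -> f = 0.
Proof.
move=> H; apply/rowP => i; rewrite mxE -(enum_valK i) -bval_key.
by apply: H; exact: bkey_pairs.
Qed.

(** The part of [bpoly f] below the leading monomial, which is linear in f. *)
Definition blow d (f : 'rV[K]_#|bidx d|) : PP :=
  \sum_(p <- bpairs d) constp (bval f p) * (tvar K ^+ p.2 * lam K ^+ (d - p.1.+1)).

Lemma blowE d (f : 'rV[K]_#|bidx d|) : blow f = \sum_(s : bidx d)
    constp (f 0 (enum_rank s)) * tvar K ^+ tagged s * lam K ^+ (d - (tag s).+1).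
Proof.
rewrite /blow -(sum_bidx d (fun j k =>
  constp (bval f (j, k)) * (tvar K ^+ k * lam K ^+ (d - j.+1)))).
by apply: eq_bigr => s _; rewrite -(bval_key f) mulrA.
Qed.

Lemma bpolyE d (f : 'rV[K]_#|bidx d|) : bpoly f = lam K ^+ d + blow f.
Proof. by rewrite blowE. Qed.

Lemma bpoly_bcoefs d (F : PP) : bpoly (bcoefs d F) = lam K ^+ d +
  \sum_(p <- bpairs d) constp (F`_(d - p.1.+1)`_p.2) * (tvar K ^+ p.2 * lam K ^+ (d - p.1.+1)).
Proof.
rewrite /bpoly; congr (_ + _).
rewrite -(sum_bidx d (fun j k =>
  constp (F`_(d - j.+1)`_k) * (tvar K ^+ k * lam K ^+ (d - j.+1)))).
by apply: eq_bigr => s _; rewrite mxE enum_rankK mulrA.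
Qed.

Lemma bcoefs_eq0 d (F : PP) : bcoefs d F = 0 ->
  forall p, p \in bpairs d -> F`_(d - p.1.+1)`_p.2 = 0.
Proof.
move=> F0 p /allpairsPdep[j [k [jd kj ->]]] /=.
rewrite !mem_iota/= !add0n in jd kj.
pose s : bidx d := Tagged (fun j : 'I_d => 'I_(j.+1)./2.+1)
  (Ordinal kj : 'I_((Ordinal jd : 'I_d).+1)./2.+1).
by have := congr1 (fun f : 'rV_#|bidx d| => f 0 (enum_rank s)) F0; rewrite !mxE enum_rankK.
Qed.

End BoundedPoly.

Section IncidenceDiff.
Variables (K : numFieldType) (n d : nat).
Local Notation PP := {poly {poly K}}.
Local Notation V := (ivec K n d).

(** The differential of the incidence equations at x in the direction v, before
    extraction of coefficients. *)
Definition idiff (x v : V) : PP :=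
  blow (lsubmx (rsubmx v)) * iG x + iF x * blow (rsubmx (rsubmx v))
  - dPpoly (chain_a (ichain x)) (chain_c (ichain x))
           (chain_a (ichain v)) (chain_c (ichain v)) n.

Lemma bpoly_diff N m (g : 'rV[K]_N -> 'rV[K]_#|bidx m|) :
  (forall i, has_diff (fun y => g y 0 i) (fun _ v => g v 0 i)) ->
  has_pdiff (fun y => bpoly (g y)) (fun _ v => blow (g v)).
Proof.
move=> Hg.
have H := has_pdiff_sum (index_enum (bidx m)) (fun s =>
   has_pdiffMr (tvar K ^+ tagged s * lam K ^+ (m - (tag s).+1))
     (has_pdiff_constp (Hg (enum_rank s)))).
apply: has_pdiff_eq (has_pdiffD (has_pdiff_cst N (lam K ^+ m)) H) => [y|y v].
  by rewrite bpolyE blowE; congr (_ + _); apply: eq_bigr => s _; rewrite mulrA.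
by rewrite add0r blowE; apply: eq_bigr => s _; rewrite mulrA.
Qed.

Lemma ieqs_diff j : has_diff (fun x : V => ieqs x 0 j)
  (fun x v => bcoefs n (idiff x v) 0 j).
Proof.
have coord m (f : V -> 'rV[K]_m) (g : 'I_m -> 'I__) i : (forall y, f y 0 i = y 0 (g i)) ->
    has_diff (fun y : V => f y 0 i) (fun _ v => f v 0 i).
  move=> fE; have := has_diff_coord K (g i); congr (has_diff _ _).
    by apply/funext => y; rewrite fE.
  by apply/funext => y; apply/funext => v; rewrite fE.
have HF : has_pdiff (fun y : V => iF y) (fun _ v => blow (lsubmx (rsubmx v))).
  apply: bpoly_diff => i; apply: (coord _ _ (fun i => rshift _ (lshift _ i))) => y.
  by rewrite !mxE.
have HG : has_pdiff (fun y : V => iG y) (fun _ v => blow (rsubmx (rsubmx v))).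
  apply: bpoly_diff => i; apply: (coord _ _ (fun i => rshift _ (rshift _ i))) => y.
  by rewrite !mxE.
have Ha k : has_diff (fun y : V => chain_a (ichain y) k) (fun _ v => chain_a (ichain v) k).
  rewrite /chain_a /rventry; case: insub => [i|]; last exact: has_diff_cst.
  by apply: (coord _ _ (fun i => lshift _ (lshift _ i))) => y; rewrite !mxE.
have Hc k : has_diff (fun y : V => chain_c (ichain y) k) (fun _ v => chain_c (ichain v) k).
  rewrite /chain_c /rventry; case: insub => [i|]; last exact: has_diff_cst.
  by apply: (coord _ _ (fun i => lshift _ (rshift _ i))) => y; rewrite !mxE.
have H := has_pdiffD (has_pdiffM HF HG) (has_pdiffN (Ppoly_diff Ha Hc n)).
have := H (n - (tag (enum_val j : bidx n)).+1)%N (tagged (enum_val j : bidx n)).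
congr (has_diff _ _).
  by apply/funext => y; rewrite mxE.
by apply/funext => y; apply/funext => v; rewrite mxE.
Qed.

Lemma ijac_slope Q x : (forall v, v *m Q = bcoefs n (idiff x v)) -> ijac x = Q^T.
Proof.
move=> QE; apply/matrixP => e v; rewrite !mxE.
rewrite (has_diff_derive x _ (ieqs_diff e)) -QE -rowE mxE.
by [].
Qed.

End IncidenceDiff.

(** * The integer certificates *)

Fixpoint zP (a c : nat -> Z) (k : nat) : zpoly :=
  match k with
  | 0 => zconst (Zpos 1)
  | k1.+1 =>
    match k1 with
    | 0 => zadd zlam (zconst (a 1%N))
    | k2.+1 => zsub (zmul (zadd zlam (zconst (a k))) (zP a c k1))
                    (zmul (zmul ztv (zconst (c k1))) (zP a c k2))
    end
  end.

Fixpoint zdP (a c da dc : nat -> Z) (k : nat) : zpoly :=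
  match k with
  | 0 => [::]
  | k1.+1 =>
    match k1 with
    | 0 => zconst (da 1%N)
    | k2.+1 => zsub (zadd (zmul (zconst (da k)) (zP a c k1))
                          (zmul (zadd zlam (zconst (a k))) (zdP a c da dc k1)))
                    (zmul ztv (zadd (zmul (zconst (dc k1)) (zP a c k2))
                                    (zmul (zconst (c k1)) (zdP a c da dc k2))))
    end
  end.

(** The integer n, negated if b holds. *)
Definition zint (b : bool) (n : nat) : Z := if b then Z.opp (Z.of_nat n) else Z.of_nat n.

(** The chain of [chain8] as lists of integers. *)
Definition za8 : seq Z := [seq zint false i | i <- [:: 7; 5; 3; 1]%N] ++
  [seq zint true i | i <- [:: 1; 3; 5; 7]%N].
Definition zc8 : seq Z := [seq Z.of_nat i | i <- [:: 7; 12; 15; 16; 15; 12; 7]%N].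

(** The chain parameters are indexed from 1; at 0, and beyond the end of the
    lists, the values agree with those of [chain_a] and [chain_c]. *)
Definition za k := nth Z0 za8 k.-1.
Definition zc k := nth Z0 zc8 k.-1.

Definition zquad (i : nat) : zpoly :=
  zsub (zmonom 2 0)
       (zmul (zconst (Z.of_nat ((2 * i + 1) ^ 2)%N)) (zadd (zconst (Zpos 1)) ztv)).

(** The product of the [quad i] over the i < 4 satisfying P. *)
Definition zquads (P : pred nat) : zpoly :=
  foldr (fun i acc => if P i then zmul (zquad i) acc else acc) (zconst (Zpos 1)) (iota 0 4).

Definition zunit (b : bool) : Z := if b then Zpos 1 else Z0.

(** The derivatives of F G - P_8 with respect to the chain parameters, the
    coefficients of F and those of G, in this order. *)
Definition zbasis (d : nat) (F G : zpoly) : seq zpoly :=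
  [seq zopp (zdP za zc (fun k => zunit (i == k.-1))
                       (fun k => zunit (i == 8 + k.-1)%N) 8) | i <- iota 0 15]
  ++ [seq zmul (zmonom (d - p.1.+1) p.2) G | p <- bpairs d]
  ++ [seq zmul F (zmonom (8 - d - p.1.+1) p.2) | p <- bpairs (8 - d)].

(** The rows of the augmented Jacobian: one for each equation, followed by one
    unit vector for each coordinate in sel. *)
Definition zrows (sel : seq nat) (B : seq zpoly) : seq (seq Z) :=
  [seq [seq zcoef P (8 - p.1.+1) p.2 | P <- B] | p <- bpairs 8]
  ++ [seq [seq zunit (i == t) | i <- iota 0 (size B)] | t <- sel].

(** The polynomial with leading monomial [lambda^d] and the bounded coefficients
    of F; equal to F when F is of the required shape. *)
Definition zbpoly d (F : zpoly) : zpoly :=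
  foldr (fun p acc => zadd (zmul (zconst (zcoef F (d - p.1.+1) p.2))
                                 (zmonom (d - p.1.+1) p.2)) acc)
        (zmonom d 0) (bpairs d).

(** All that has to be computed for the grouping in which F is the product of the
    quadratics marked in bs: F and G have bounded coefficients, their product is
    P_8, and the augmented Jacobian has trivial kernel.  The columns are
    eliminated from the last one, which keeps the entries small. *)
Definition zcheck d sel (bs : seq bool) : bool :=
  let F := zquads (nth false bs) in
  let G := zquads (fun i => ~~ nth false bs i) in
  let B := zbasis d F G in
  [&& zeqp (zbpoly d F) F, zeqp (zbpoly (8 - d) G) G, zeqp (zmul F G) (zP za zc 8)
    & kertriv (size B) [seq rev r | r <- zrows sel B]].

(** The selected coordinates are a_1, ..., a_8 and c_1. *)
Lemma zcheck2 bs : size bs = 4%N -> count id bs = 1%N -> zcheck 2 (iota 0 9) bs.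
Proof.
case: bs => [|b0 [|b1 [|b2 [|b3 [|b4 bs]]]]] H; try discriminate H; clear H.
by move: b0 b1 b2 b3 => [] [] [] [] H; first [discriminate H | vm_cast_no_check (erefl true)].
Qed.

(** The selected coordinates are a_1, ..., a_6 and c_1, the latter in position 8. *)
Lemma zcheck4 bs : size bs = 4%N -> count id bs = 2%N -> zcheck 4 (rcons (iota 0 6) 8) bs.
Proof.
case: bs => [|b0 [|b1 [|b2 [|b3 [|b4 bs]]]]] H; try discriminate H; clear H.
by move: b0 b1 b2 b3 => [] [] [] [] H; first [discriminate H | vm_cast_no_check (erefl true)].
Qed.

Lemma zchain8 : zeqp (zquads predT) (zP za zc 8).
Proof. by vm_cast_no_check (erefl true). Qed.

(** * Evaluation at the given chain *)

(* simplification must not unfold the products of concrete lists *)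
Arguments zadd : simpl never.
Arguments zmul : simpl never.
Arguments zopp : simpl never.
Arguments zsub : simpl never.
Arguments zquad : simpl never.

Section Evaluate.
Variable K : numFieldType.
Local Notation PP := {poly {poly K}}.

Lemma zK_nat n : zK K (Z.of_nat n) = n%:R.
Proof.
by rewrite /zK -{1}(natn n) (rmorph_nat Z.of_nat) (rmorph_nat int_of_Z) rmorph_nat.
Qed.

Lemma zK_unit b : zK K (zunit b) = b%:R.
Proof. by case: b; rewrite /zunit ?zK0 ?zK1. Qed.

Lemma zPE a c n : pev K (zP a c n) = Ppoly (zK K \o a) (zK K \o c) n.
Proof.
suff [] : pev K (zP a c n) = Ppoly (zK K \o a) (zK K \o c) n /\
  pev K (zP a c n.+1) = Ppoly (zK K \o a) (zK K \o c) n.+1 by [].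
elim: n => [|n [IH1 IH2]]; split => //.
- by rewrite pev_const zK1 /constp !polyC1.
- by rewrite pevD pev_lam pev_const.
rewrite -[zP a c n.+2]/(zsub (zmul (zadd zlam (zconst (a n.+2))) (zP a c n.+1))
                    (zmul (zmul ztv (zconst (c n.+1))) (zP a c n))).
by rewrite pevB !pevM pevD pev_lam pev_tv !pev_const IH1 IH2.
Qed.

Lemma zdPE a c da dc n : pev K (zdP a c da dc n) =
  dPpoly (zK K \o a) (zK K \o c) (zK K \o da) (zK K \o dc) n.
Proof.
suff [] : pev K (zdP a c da dc n) =
  dPpoly (zK K \o a) (zK K \o c) (zK K \o da) (zK K \o dc) n /\
  pev K (zdP a c da dc n.+1) =
  dPpoly (zK K \o a) (zK K \o c) (zK K \o da) (zK K \o dc) n.+1 by [].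
elim: n => [|n [IH1 IH2]]; split => //; first by rewrite pev_const.
rewrite -[zdP a c da dc n.+2]/(zsub (zadd (zmul (zconst (da n.+2)) (zP a c n.+1))
                          (zmul (zadd zlam (zconst (a n.+2))) (zdP a c da dc n.+1)))
                    (zmul ztv (zadd (zmul (zconst (dc n.+1)) (zP a c n))
                                    (zmul (zconst (c n.+1)) (zdP a c da dc n))))).
by rewrite pevB pevD !pevM pevD pevD !pevM pev_lam pev_tv !pev_const IH1 IH2 !zPE.
Qed.

Lemma zquadE (i : 'I_4) : pev K (zquad i) = quad K i.
Proof.
rewrite pevB pevM pevD pev_monom !pev_const pev_tv zK_nat zK1 expr0 mul1r.
by rewrite /quad natrX /constp !polyC1.
Qed.

Lemma zquadsE (P : pred nat) : pev K (zquads P) = \prod_(i < 4 | P i) quad K i.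
Proof.
transitivity (\prod_(i <- iota 0 4 | P i) pev K (zquad i)).
  rewrite /zquads; elim: (iota 0 4) => [|i r IH] /=.
    by rewrite big_nil pev_const zK1 /constp !polyC1.
  by rewrite big_cons -IH; case: (P i) => //; exact: pevM.
rewrite -[iota 0 4]/(index_iota 0 4) big_mkord.
by apply: eq_bigr => i _; rewrite zquadE.
Qed.

Lemma zbpolyE d (F : zpoly) : pev K (zbpoly d F) = bpoly (bcoefs d (pev K F)).
Proof.
rewrite bpoly_bcoefs /zbpoly; elim: (bpairs d) => [|p r IH] /=.
  by rewrite big_nil addr0 pev_monom expr0 mul1r.
by rewrite pevD pevM pev_const pev_monom IH big_cons pev_coef addrCA.
Qed.

Lemma chain8_a k : chain_a (chain8 K) k = zK K (za k).
Proof.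
rewrite /chain_a row_mxKl /rventry /za; move: k.-1 => {}k.
case: insubP => [i _ <-|k8]; last by rewrite nth_default ?zK0// leqNgt.
rewrite mxE.
have -> : [:: 7; 5; 3; 1; -1; -3; -5; -7] = map (zK K) za8.
  have zKi b : zK K \o zint b =1 (fun l => if b then - l%:R else l%:R).
    by move=> l; case: b; rewrite /= ?zKN zK_nat.
  by rewrite /za8 map_cat -!map_comp !(eq_map (zKi _)).
by rewrite (nth_map Z0)// size_cat.
Qed.

Lemma chain8_c k : chain_c (chain8 K) k = zK K (zc k).
Proof.
rewrite /chain_c row_mxKr /rventry /zc; move: k.-1 => {}k.
case: insubP => [i _ <-|k8]; last by rewrite nth_default ?zK0// leqNgt.
rewrite mxE.
have -> : [:: 7; 12; 15; 16; 15; 12; 7] = map (zK K) zc8.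
  by rewrite /zc8 -map_comp (eq_map zK_nat).
by rewrite (nth_map Z0).
Qed.

Lemma chainP8 : chainP (chain8 K) = pev K (zP za zc 8).
Proof.
rewrite /chainP zPE; congr Ppoly; apply/funext => k.
  exact: chain8_a.
exact: chain8_c.
Qed.

Lemma zK_inj : injective (zK K).
Proof.
move=> x y /eqP; rewrite -subr_eq0 -zKN -zKD zK_eq0 => /eqP xy.
by apply/Z.sub_move_0_r.
Qed.

Lemma chain8_U : chainU (chain8 K).
Proof.
split.
  move=> i j; have E (l : 'I_8) : lsubmx (chain8 K) 0 l = zK K (nth Z0 za8 l).
    rewrite -[l : nat in RHS]/(l.+1.-1) -/(za l.+1) -chain8_a /chain_a /rventry /=.
    by rewrite valK.
  rewrite !E => /zK_inj /eqP; rewrite nth_uniq// => [/eqP/val_inj//].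
apply/prodf_neq0 => i _ /=.
have -> : rsubmx (chain8 K) 0 i = zK K (nth Z0 zc8 i).
  rewrite -[i : nat in RHS]/(i.+1.-1) -/(zc i.+1) -chain8_c /chain_c /rventry /=.
  by rewrite valK.
rewrite zK_eq0.
have /allP : all (fun z => z != Z0) zc8 by [].
by apply; apply: mem_nth.
Qed.

Lemma near_neq0 (V : topologicalType) (g : V -> K) p :
  {for p, continuous g} -> g p != 0 -> \forall y \near p, g y != 0.
Proof.
move=> /cvgrPdist_lt gc gp; have := gc `|g p|; rewrite normr_gt0 => /(_ gp).
apply: filterS => y; apply: contraTneq => ->.
by rewrite subr0 ltxx.
Qed.

Lemma chainU_nbhs n (p : 'rV[K]_(n + n.-1)) : chainU p -> nbhs p (@chainU K n).
Proof.
move=> [ainj cprod].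
have F : Filter (nbhs p) by exact: nbhs_filter.
have Ha : \forall y \near p, forall ij : 'I_n * 'I_n, ij.1 != ij.2 ->
    lsubmx y 0 ij.1 - lsubmx y 0 ij.2 != 0.
  apply: (@filter_forall _ _ (fun (ij : 'I_n * 'I_n) (y : 'rV[K]_(n + n.-1)) =>
    ij.1 != ij.2 -> lsubmx y 0 ij.1 - lsubmx y 0 ij.2 != 0) _ F) => -[i j] /=.
  have [<-|ij] := eqVneq i j; first by apply: nearW.
  have pij : p 0 (lshift _ i) - p 0 (lshift _ j) != 0.
    rewrite subr_eq0; apply: contra ij => /eqP pij; apply/eqP/ainj.
    by rewrite !mxE.
  have [_ [gc _ _ _]] := has_diffD (has_diff_coord K (lshift n.-1 i))
    (has_diffN (has_diff_coord K (lshift n.-1 j))).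
  have := near_neq0 (gc p) pij.
  by apply: filterS => y + _; rewrite !mxE.
have Hc : \forall y \near p, forall i : 'I_n.-1, rsubmx y 0 i != 0.
  apply: (@filter_forall _ _ (fun (i : 'I_n.-1) (y : 'rV[K]_(n + n.-1)) =>
    rsubmx y 0 i != 0) _ F) => i /=.
  have pi : p 0 (rshift n i) != 0.
    move/prodf_neq0: cprod => /(_ i isT).
    by rewrite mxE.
  have [_ [gc _ _ _]] := has_diff_coord K (rshift n i).
  have := near_neq0 (gc p) pi.
  by apply: filterS => y; rewrite !mxE.
apply: filterS2 Ha Hc => y ya yc; split.
  move=> i j aij; apply/eqP; apply/negPn/negP => ij.
  by have := ya (i, j) ij; rewrite /= aij subrr eqxx.
by apply/prodf_neq0 => i _; exact: yc.
Qed.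

End Evaluate.

(** * The kernel of the augmented Jacobian *)

Section Certificate.
Variable K : numFieldType.
Hypothesis HK : geom_complete K.

Lemma lin_coef (w : seq K) (B : seq zpoly) a b :
  (\sum_(u <- zip w B) constp u.1 * pev K u.2)`_a`_b =
  dot [seq zcoef P a b | P <- B] w.
Proof.
elim: w B => [|y w IH] [|P B] /=; rewrite ?big_nil ?coef0//.
by rewrite big_cons !coefD IH /constp !coefCM pev_coef mulrC.
Qed.

Lemma sum_delta (g : nat -> K) j m : (j < m)%N ->
  \sum_(i <- iota 0 m) g i * zK K (zunit (i == j)) = g j.
Proof.
move=> jm; rewrite (bigD1_seq j) ?iota_uniq ?mem_iota//= eqxx zK_unit mulr1.
by rewrite big1 ?addr0// => i /negPf ->; rewrite zK_unit mulr0.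
Qed.

Lemma dot_iota (h : nat -> Z) (w : seq K) m :
  dot [seq h i | i <- iota m (size w)] w =
  \sum_(i <- iota m (size w)) nth 0 w (i - m) * zK K (h i).
Proof.
elim: w m => [|y w IH] m /=; first by rewrite big_nil.
rewrite big_cons subnn mulrC /= IH; congr (_ + _); apply: eq_big_seq => i.
by rewrite mem_iota => /andP[mi _]; rewrite -[(i - m)%N]prednK ?subn_gt0// subnS.
Qed.

Lemma dot_unit (w : seq K) t : (t < size w)%N ->
  dot [seq zunit (i == t) | i <- iota 0 (size w)] w = nth 0 w t.
Proof.
move=> tw; rewrite dot_iota -[RHS](sum_delta (nth 0 w) tw).
by apply: eq_bigr => i _; rewrite subn0.
Qed.

Lemma sum_zip_map (S : Type) (f : S -> K) (g : S -> zpoly) s :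
  \sum_(u <- zip (map f s) (map g s)) constp u.1 * pev K u.2 =
  \sum_(i <- s) constp (f i) * pev K (g i).
Proof. by elim: s => [|i s IH]; rewrite ?big_nil// !big_cons -IH. Qed.

Lemma nth_map_iota_cat (g : nat -> K) m s t : (t < m)%N ->
  nth 0 ([seq g i | i <- iota 0 m] ++ s) t = g t.
Proof.
by move=> tm; rewrite nth_cat size_map size_iota tm (nth_map 0%N) ?size_iota// nth_iota.
Qed.

(** The coordinates of a tangent vector, in the order of [zbasis]. *)
Definition coords d (v : ivec K 8 d) : seq K :=
  [seq rventry (lsubmx v) i | i <- iota 0 15] ++
  [seq bval (lsubmx (rsubmx v)) p | p <- bpairs d] ++
  [seq bval (rsubmx (rsubmx v)) p | p <- bpairs (8 - d)].

Lemma rventry_ord m (p : 'rV[K]_m) (i : 'I_m) : rventry p i = p 0 i.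
Proof. by rewrite /rventry valK. Qed.

Lemma chain_a_rventry (p : 'rV[K]_(8 + 8.-1)) k : (k.-1 < 8)%N ->
  chain_a p k = rventry p k.-1.
Proof.
rewrite /chain_a; move: k.-1 => {}k k8.
rewrite -[k]/(val (Ordinal k8)) rventry_ord mxE.
exact: esym (rventry_ord p (lshift _ (Ordinal k8))).
Qed.

Lemma chain_c_rventry (p : 'rV[K]_(8 + 8.-1)) k : (k.-1 < 7)%N ->
  chain_c p k = rventry p (8 + k.-1).
Proof.
rewrite /chain_c; move: k.-1 => {}k k7.
rewrite -[k in LHS]/(val (Ordinal k7)) rventry_ord mxE.
exact: esym (rventry_ord p (rshift 8 (Ordinal k7))).
Qed.

(** The incidence Jacobian at a point over [chain8] is the matrix of [zrows]. *)
Lemma idiff_coords d (x v : ivec K 8 d) (F G : zpoly) :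
  ichain x = chain8 K -> iF x = pev K F -> iG x = pev K G ->
  idiff x v = \sum_(u <- zip (coords v) (zbasis d F G)) constp u.1 * pev K u.2.
Proof.
move=> xE FE GE.
rewrite /coords /zbasis !zip_cat ?size_map// !big_cat !sum_zip_map.
rewrite /idiff FE GE xE.
have -> : chain_a (chain8 K) = zK K \o za by apply/funext => k; exact: chain8_a.
have -> : chain_c (chain8 K) = zK K \o zc by apply/funext => k; exact: chain8_c.
rewrite (@dPpoly_lin _ _ (iota 0 15) (rventry (lsubmx v)) _ _ _ _
  (fun i k => zK K (zunit (i == k.-1)))
  (fun i k => zK K (zunit (i == 8 + k.-1)%N))); last 2 first.
- move=> k /andP[k0 k8]; have k8' : (k.-1 < 8)%N by rewrite prednK.
  by rewrite chain_a_rventry// sum_delta// (leq_trans k8').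
- move=> k /andP[k0 k8]; have k7 : (k.-1 < 7)%N by rewrite -ltnS prednK.
  by rewrite chain_c_rventry// sum_delta// (ltn_add2l 8 _ 7).
rewrite addrC -sumrN; congr (_ + (_ + _)).
- by apply: eq_bigr => i _; rewrite pevN zdPE mulrN.
- rewrite /blow mulr_suml; apply: eq_bigr => p _.
  by rewrite pevM pev_monom -!mulrA.
- rewrite /blow mulr_sumr; apply: eq_bigr => p _.
  by rewrite pevM pev_monom mulrCA.
Qed.

Lemma coords_eq0 d (v : ivec K 8 d) : (forall y, y \in coords v -> y = 0) -> v = 0.
Proof.
move=> H.
have v1 : lsubmx v = 0.
  apply/rowP => i; rewrite [RHS]mxE -rventry_ord; apply: H.
  by rewrite mem_cat map_f// mem_iota/= (ltn_ord i).
have v2 : lsubmx (rsubmx v) = 0.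
  apply: bval_eq0 => p pd; apply: H.
  by rewrite !mem_cat map_f ?orbT.
have v3 : rsubmx (rsubmx v) = 0.
  apply: bval_eq0 => p pd; apply: H.
  by rewrite !mem_cat [in X in _ || (_ || X)]map_f ?orbT.
by rewrite -[v]hsubmxK v1 -[rsubmx v]hsubmxK v2 v3 !row_mx0.
Qed.

(** The selection of chain coordinates given by a list of positions below 15. *)
Definition sel_fun (sel : seq nat) (l : 'I_(size sel)) : 'I_(8 + 8.-1) :=
  (inord (nth 0%N sel l) : 'I_15).

(** A successful elimination means that the augmented Jacobian has trivial
    kernel at every point over [chain8] with these factors. *)
Lemma kernel_trivial d (x v : ivec K 8 d) (F G : zpoly) sel :
  ichain x = chain8 K -> iF x = pev K F -> iG x = pev K G ->
  all (fun t => t < 15)%N sel ->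
  kertriv (size (zbasis d F G)) [seq rev r | r <- zrows sel (zbasis d F G)] ->
  bcoefs 8 (idiff x v) = 0 -> colsub (@sel_fun sel) (lsubmx v) = 0 -> v = 0.
Proof.
move=> xE FE GE sel15 ker v0 sv0.
have sizeE : size (coords v) = size (zbasis d F G).
  by rewrite /coords /zbasis !size_cat !size_map.
suff E : rev (coords v) = nseq (size (zbasis d F G)) 0.
  by apply: coords_eq0 => y; rewrite -mem_rev E => /nseqP[].
have sizeR : size (rev (coords v)) = size (zbasis d F G) by rewrite size_rev.
apply: (kertrivP ker sizeR) => _ /mapP[r rin ->].
rewrite dot_rev; last first.
  by move: rin; rewrite mem_cat => /orP[] /mapP[t _ ->]; rewrite size_map ?size_iota.
move: rin; rewrite mem_cat => /orP[] /mapP[].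
  move=> p p8 ->; rewrite -lin_coef -(idiff_coords v xE FE GE).
  exact: bcoefs_eq0.
move=> t tsel ->; have t15 : (t < 15)%N := allP sel15 _ tsel.
rewrite -sizeE dot_unit; last by rewrite /coords size_cat size_map (leq_trans t15)// leq_addr.
rewrite /coords (nth_map_iota_cat _ _ t15).
have tl : (index t sel < size sel)%N by rewrite index_mem.
have := congr1 (fun w : 'rV_(size sel) => w 0 (Ordinal tl)) sv0; rewrite !mxE => <-.
have tE : (sel_fun (Ordinal tl) : nat) = t by rewrite /sel_fun /= inordK nth_index.
by have := rventry_ord (lsubmx v) (sel_fun (Ordinal tl)); rewrite tE mxE.
Qed.

(** The characteristic function of A as a list of four booleans. *)
Definition bits (A : {set 'I_4}) : seq bool := [seq i \in A | i <- enum 'I_4].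

Lemma size_bits A : size (bits A) = 4%N.
Proof. by rewrite size_map size_enum_ord. Qed.

Lemma nth_bits A (i : 'I_4) : nth false (bits A) i = (i \in A).
Proof. by rewrite (nth_map ord0) ?size_enum_ord// nth_ord_enum. Qed.

Lemma count_bits A : count id (bits A) = #|A|.
Proof. by rewrite count_map cardE enumT -size_filter. Qed.

(** The grouping A, with d = 2 #|A|, for any list of selected chain coordinates
    that the certificate accepts. *)
Theorem point8_branch d r sel (A : {set 'I_4}) : zcheck d sel (bits A) ->
  all (fun t => t < 15)%N sel ->
  (#|bidx 8| + size sel = 8 + 8.-1 + (#|bidx d| + #|bidx (8 - d)|))%N ->
  (size sel + r = 8 + 8.-1)%N ->
  let x := point8 K d A in
  [/\ iF x = quads K A, iG x = quads K (~: A), incidence x,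
      \rank (ijac x) = #|bidx 8| & branch_image_codim x r].
Proof.
set F := zquads (nth false (bits A)).
set G := zquads (fun i => ~~ nth false (bits A) i).
move=> /and4P[zF zG zFG ker] sel15 dimE krq x.
have FE : pev K F = quads K A.
  by rewrite zquadsE; apply: eq_bigl => i; rewrite nth_bits.
have GE : pev K G = quads K (~: A).
  by rewrite zquadsE; apply: eq_bigl => i; rewrite nth_bits finset.in_setC.
have xF : iF x = pev K F.
  by rewrite /iF row_mxKr row_mxKl -FE -zbpolyE; exact: zeqpP.
have xG : iG x = pev K G.
  by rewrite /iG row_mxKr row_mxKr -GE -zbpolyE; exact: zeqpP.
have xC : ichain x = chain8 K by rewrite /ichain row_mxKl.
have x0 : ieqs x = 0.
  rewrite /ieqs xF xG xC chainP8 -pevM (zeqpP K zFG) subrr.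
  by apply/rowP => j; rewrite !mxE /= !coef0.
have [Q QS QE] := has_diff_slope (@ieqs_diff K 8 d).
have kerx (v : ivec K 8 d) :
    v *m Q x x = 0 -> colsub (@sel_fun sel) (lsubmx v) = 0 -> v = 0.
  by rewrite QE; exact: kernel_trivial xC xF xG sel15 ker.
split; [by rewrite xF | by rewrite xG | | | ].
- by split; [rewrite xC; exact: chain8_U | exact: x0].
- rewrite (ijac_slope (QE x)) mxrank_tr.
  exact: slope_rank kerx dimE.
- have Ux : nbhs (lsubmx x) (@chainU K 8).
    by apply: chainU_nbhs; rewrite -/(ichain x) xC; exact: chain8_U.
  exact: (local_image_codim HK QS x0 Ux kerx dimE krq).
Qed.

End Certificate.

Theorem proposition7p5 (R : realType) :
  [/\ @chainU (cplx R) 8 (chain8 (cplx R)),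
      chainP (chain8 (cplx R)) = \prod_(i < 4) quad (cplx R) i,
      [/\ #|bidx 8| = 24%N,
          (8 + 8.-1 + (#|bidx 2| + #|bidx (8 - 2)|) = 33)%N
        & (8 + 8.-1 + (#|bidx 4| + #|bidx (8 - 4)|) = 31)%N],
      forall i : 'I_4,
        let x := point8 (cplx R) 2 [set i] in
        [/\ iF x = quad (cplx R) i,
            iG x = \prod_(j < 4 | j != i) quad (cplx R) j,
            @incidence (cplx R) 8 2 x,
            \rank (ijac x) = 24%N
          & branch_image_codim x 6]
    & forall A : {set 'I_4}, #|A| = 2%N ->
        let x := point8 (cplx R) 4 A in
        [/\ iF x = \prod_(i in A) quad (cplx R) i,
            iG x = \prod_(i in ~: A) quad (cplx R) i,
            @incidence (cplx R) 8 4 x,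
            \rank (ijac x) = 24%N
          & branch_image_codim x 8]].
Proof.
have HK := cplx_geom_complete R.
split.
- exact: chain8_U.
- rewrite chainP8 -(zeqpP _ zchain8) zquadsE.
  by apply: eq_bigl.
- by rewrite !card_bidx.
- move=> i x.
  have chk : zcheck 2 (iota 0 9) (bits [set i]).
    by apply: zcheck2; rewrite ?size_bits// count_bits cards1.
  have dimE : (#|bidx 8| + 9 = 8 + 8.-1 + (#|bidx 2| + #|bidx (8 - 2)|))%N.
    by rewrite !card_bidx.
  have [xF xG xI xr xc] := @point8_branch _ HK 2 6 _ _ chk isT dimE erefl.
  split; [ | | exact: xI | by rewrite xr card_bidx | exact: xc].
    by rewrite xF /quads big_set1.
  by rewrite xG; apply: eq_bigl => j; rewrite finset.in_setC1.
- move=> A A2 x.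
  have chk : zcheck 4 (rcons (iota 0 6) 8) (bits A).
    by apply: zcheck4; rewrite ?size_bits// count_bits.
  have dimE : (#|bidx 8| + 7 = 8 + 8.-1 + (#|bidx 4| + #|bidx (8 - 4)|))%N.
    by rewrite !card_bidx.
  have [xF xG xI xr xc] := @point8_branch _ HK 4 8 _ _ chk isT dimE erefl.
  by split; [exact: xF | exact: xG | exact: xI | rewrite xr card_bidx | exact: xc].
Qed.
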